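(* Let $G$ be a finite group. Then $G$ admits an automorphism $\alpha$ with $r_3(G,\alpha) > 1/2$ if and only if $G$ has one of the following structures. **I.** $G$ is abelian and $(|G|,3)=1$. **II.** $G$ is non-abelian with a normal Sylow $3$-subgroup $S$ satisfying the following conditions: (a) $S \subseteq K$ for some subgroup $K$ of $G$ such that $(G:K)=2$ and $K$ is abelian; (b) $S \cap Z(G) = \{1\}$. In particular, if $(|G|,3)=1$ (and $G$ is non-abelian) then it suffices for $G$ to have an abelian subgroup of index $2$. **III.** $G$ is nilpotent of class two and $(|G|,3)=1$. All Sylow $p$-subgroups of $G$, for $p>2$, are abelian. The Sylow $2$-subgroup $S_2$ of $G$, with center $Z = Z(S_2)$, has one of the following structures: (i) $S_2' \cong C_2 = \langle z\rangle$, say, and $S_2/Z(S_2)$ is elementary abelian, generated by $Zx_1,\dots,Zx_k, Za_1,\dots,Za_k$ (for some $k\ge 1$ and $x_i,a_i\in S_2$), subject to the commutator relations $$[x_i,x_j]=[a_i,a_j]=[a_i,x_j]=1 \text{ whenever } i\neq j, \qquad [a_i,x_i]=z \text{ for all } i.$$ (ii) $S_2' \cong C_2\times C_2 = \langle z_1\rangle\times\langle z_2\rangle$, say, and $S_2/Z(S_2)$ is elementary abelian of order $16$, generated by $Zx_1,Zx_2,Za_1,Za_2$ (with $x_i,a_i\in S_2$), subject to the commutator relations $$[x_i,x_j]=[a_i,a_j]=[a_i,x_j]=1 \text{ whenever } i\neq j, \qquad [a_i,x_i]=z_i \text{ for } i=1,2.$$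
   Context: For a finite group $G$ and an automorphism $\alpha$ of $G$ (written on the right), put $T_{3,\alpha}=\{g\in G : g\alpha = g^3\}$ and $r_3(G,\alpha)=|T_{3,\alpha}|/|G|$. $(G:K)$ denotes the index of the subgroup $K$ in $G$, $(m,n)$ denotes the greatest common divisor of integers $m,n$, $[x,y]=x^{-1}y^{-1}xy$, $S_2'$ is the commutator subgroup of $S_2$, $C_2$ is the cyclic group of order $2$, and $Z(\cdot)$ denotes the center. *)

(* Defs.v *)
From HB Require Import structures.
From mathcomp Require Import all_boot all_order all_algebra all_fingroup all_solvable.

Set Implicit Arguments.
Unset Strict Implicit.
Unset Printing Implicit Defensive.

Import Order.TTheory GRing.Theory Num.Theory GroupScope.

Section Cubing.

Variable gT : finGroupType.
Implicit Types (G S K : {group gT}) (alpha : {perm gT}).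

Definition cubed_set G alpha : {set gT} := [set g in G | alpha g == g ^+ 3].

Definition cube_ratio G alpha : rat := (#|cubed_set G alpha|%:R / #|G|%:R)%R.

Definition structureI G : Prop := abelian G /\ coprime #|G| 3.

Definition structureII G : Prop :=
  ~~ abelian G /\
  exists S : {group gT},
    [/\ 3.-Sylow(G) S, S <| G,
        exists K : {group gT},
          [/\ S \subset K, K \subset G, #|G : K| = 2 & abelian K]
      & S :&: 'Z(G) = 1].

(* S / Z(S) is generated by the cosets of the x_i and the a_i; the only
   nontrivial commutators among these generators are [a_i, x_i] = z_i. *)
Definition hyperbolic_generators S (k : nat) (x a z : 'I_k -> gT) : Prop :=
  [/\ forall i, x i \in S /\ a i \in S,
      S / 'Z(S) = << [set coset 'Z(S) (x i) | i : 'I_k]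
                     :|: [set coset 'Z(S) (a i) | i : 'I_k] >>,
      forall i j, i != j ->
        [/\ [~ x i, x j] = 1, [~ a i, a j] = 1 & [~ a i, x j] = 1]
    & forall i, [~ a i, x i] = z i].

Definition structureIIIi S : Prop :=
  exists (z : gT) (k : nat) (x a : 'I_k -> gT),
    [/\ S^`(1) = <[z]>, #[z] = 2, 2.-abelem (S / 'Z(S)), 0 < k
      & hyperbolic_generators S x a (fun=> z)].

Definition structureIIIii S : Prop :=
  exists z x a : 'I_2 -> gT,
    [/\ <[z ord0]> \x <[z ord_max]> = S^`(1), forall i, #[z i] = 2,
        2.-abelem (S / 'Z(S)), #|S / 'Z(S)| = 16
      & hyperbolic_generators S x a z].

Definition structureIII G : Prop :=
  [/\ nilpotent G, nil_class G = 2, coprime #|G| 3,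
      forall (p : nat) (P : {group gT}),
        prime p -> 2 < p -> p.-Sylow(G) P -> abelian P
    & exists S : {group gT},
        2.-Sylow(G) S /\ (structureIIIi S \/ structureIIIii S)].

End Cubing.

(* Main.v *)
Require Import Defs.
From HB Require Import structures.
From mathcomp Require Import all_boot all_order all_algebra all_fingroup all_solvable.
From mathcomp Require Import zify.

Set Implicit Arguments.
Unset Strict Implicit.
Unset Printing Implicit Defensive.

Import Order.TTheory GRing.Theory Num.Theory GroupScope.

(** Let T be the set of elements that alpha sends to their cubes.  For x, y in T
    the product x y lies in T exactly when (y x)^2 = x^2 y^2, and for x, h in T
    the conjugate x^h lies in T exactly when h^2 commutes with x.  Assume that T
    contains more than half of G.  Central elements are then in T, so 3 does not
    divide |Z(G)|.

    Suppose that h^2 is not central for some h in T.  For g outside C(h^2), the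
    elements g, h g, h^2 g, h^3 g have together at most |<h>| conjugates by
    elements of <h> in T: three consecutive translates having such conjugates
    would force h^2 to commute with g (four_term_obstruction).  Hence T contains
    at most a quarter of G - C(h^2) (cubed_outside_square_centralizer), which is
    only possible if C(h^2) has index 2 and more than three quarters of it lies
    in T.  The same estimate inside C(h^2) shows that it is abelian, and G has
    structure II (noncentral_square_structureII).

    Suppose next that all squares of elements of T are central.  Now x y lies in
    T exactly when x and y commute, as for automorphisms inverting many elements.
    Let A be an abelian subgroup contained in T, of maximal order.  For x in T the
    coset A x meets T in C_A(x) x, so every coset meets T, and all cosets other
    than A, with at most one exception, meet it in half of their elements; x is
    good when this holds for A x.  If x is good and H = C_A(x), then C_G(H) has
    an abelian subgroup K of index 2 whose complement lies in T
    (hyperplane_complement).  Either H is central, so that C_G(H) is G and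
    structure II holds, or counting in the cosets of C_G(H) leaves only the
    union of A and A x (hyperplane_cent_small).  It follows that A is normal,
    that [a, x] for a in A has a single nontrivial value, which is central, and
    that G has class two with G / Z(G) of exponent 2.  If all good x have the
    same value then G' has order 2, and a symplectic basis gives structure
    III (i) (hyperbolic_decomposition).  If x and y have different values then
    A x y is the exceptional coset and |G : A| = 4, which is structure III (ii)
    (two_values).

    Conversely, in structures I and III one has G = A X with A and X abelian and
    with [A, X] central of exponent at most 2.  Then a x |-> a^3 x^3 is an
    automorphism that cubes the products of commuting a and x, and these are
    more than half of G (split_cubing_majority).  In structure II an automorphism
    cubes 1 and all elements outside K (structureII_automorphism). *)

(** Left-associated reduced form of an explicit group word. *)
Ltac reduce_words :=
  rewrite ?(commgEl, conjgE, expgS, expg0, invMg, invgK, invg1, mulg1, mul1g, mulgA,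
            mulgK, mulgKV, mulgV, mulVg).

(** Cardinals of the same set often carry different but convertible structure
    terms; naming them up to conversion lets linear arithmetic identify them. *)
Ltac name_cards :=
  match goal with
  | |- context [@card.body ?t ?A] =>
      let n := fresh "n" in
      pose n := (@card.body t A);
      repeat match goal with
      | |- context [@card.body ?t1 ?A1] =>
          change (@card.body t1 A1) with n
      end;
      clearbody n; name_cards
  | _ => idtac
  end.

Ltac card_lia :=
  repeat match goal with
  | H : is_true (leq _ _) |- _ => revert H
  | H : @eq nat _ _ |- _ => revert H
  end;
  name_cards;
  repeat match goal with H : _ |- _ => clear H end;
  intros; lia.

(** * Counting in finite groups *)

Section Generalities.

Variable gT : finGroupType.
Implicit Types (A G H K : {group gT}) (U V S W : {set gT}) (g x y z : gT).

Lemma index2_mul G K x y :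
    K \subset G -> #|G : K| = 2 -> x \in G -> y \in G ->
  (x * y \in K) = ((x \in K) == (y \in K)).
Proof.
move=> sKG iGK Gx Gy; have [Ky | nKy] := boolP (y \in K).
  by rewrite groupMr // eqb_id.
have [Kx | nKx] := boolP (x \in K); first by rewrite groupMl // (negPf nKy).
have eqKy : K :* y^-1 = G :\: K.
  apply/eqP; rewrite eqEcard card_rcoset cardsD (setIidPr sKG) -(Lagrange sKG) iGK.
  rewrite muln2 -addnn addnK leqnn andbT; apply/subsetP=> z.
  rewrite mem_rcoset invgK inE => Kzy; have Gzy := subsetP sKG _ Kzy.
  rewrite -(groupMr z Gy) Gzy andbT; apply: contra nKy => Kz.
  by rewrite -(groupMl y Kz).
have : x \in K :* y^-1 by rewrite eqKy inE nKx.
by rewrite mem_rcoset invgK.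
Qed.

Lemma large_subgroup G K : K \subset G -> #|G| < 2 * #|K| -> K :=: G.
Proof.
move=> sKG ltG; apply/eqP; rewrite eqEcard sKG -(Lagrange sKG).
move: ltG; rewrite -(Lagrange sKG) mulnC ltn_pmul2r // => i2.
have -> : #|G : K| = 1%N by have := indexg_gt0 G K; lia.
by rewrite mul1n leqnn.
Qed.

Lemma subsets_meet U S S' :
  S \subset U -> S' \subset U -> #|U| < #|S| + #|S'| -> exists2 x, x \in S & x \in S'.
Proof.
move=> sSU sS'U; rewrite -cardsUI => ltU.
have : S :&: S' != set0.
  rewrite -card_gt0; have : #|S :|: S'| <= #|U| by rewrite subset_leq_card // subUset sSU.
  by lia.
by case/set0Pn=> x /setIP[Sx S'x]; exists x.
Qed.

Lemma coprime_root_in A x n : coprime #[x] n -> x ^+ n \in A -> x \in A.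
Proof.
move=> cox; have := generator_coprime x n; rewrite cox /generator => /eqP gE.
by rewrite -!cycle_subG gE.
Qed.

(** Averaging over translates: an injection of U into U permutes U, so it does
    not change how many elements of U fall into S. *)
Lemma card_preim_stable (f : gT -> gT) U S :
    injective f -> {in U, forall g, f g \in U} ->
  #|[set g in U | f g \in S]| = #|U :&: S|.
Proof.
move=> injf fU; have fUU : f @: U = U.
  apply/eqP; rewrite eqEcard card_imset // leqnn andbT.
  by apply/subsetP=> _ /imsetP[g Ug ->]; apply: fU.
rewrite -(card_imset _ injf); apply: eq_card => x; rewrite inE.
apply/imsetP/andP=> [[g + ->] | [+ Sx]]; first by rewrite inE => /andP[/fU].
by rewrite -{1}fUU => /imsetP[g Ug xE]; exists g; rewrite // inE Ug -xE.
Qed.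

Lemma sum_card_cosets A U S :
    {in A & U, forall a g, a * g \in U} ->
  (\sum_(g in U) #|S :&: A :* g| = #|A| * #|S :&: U|)%N.
Proof.
move=> AU.
rewrite (eq_bigr (fun g => \sum_(a in A) ((a * g)%g \in S))%N) => [|g _].
  rewrite exchange_big /= (eq_bigr (fun=> #|S :&: U|)) => [|a Aa].
    by rewrite sum_nat_const.
  rewrite -big_mkcondr /= sum1dep_card setIC.
  by rewrite -(card_preim_stable (f := fun g => a * g)) // => [|g Ug]; [exact: mulgI | exact: AU].
rewrite -big_mkcondr /= sum1dep_card -(card_rcoset _ g).
apply: eq_card => x; rewrite mem_rcoset !inE mem_rcoset mulgKV.
by rewrite andbC.
Qed.

(** Each element of S in U lies in the cosets of |A| elements of U, so a bound
    on every coset bounds the density of S in U. *)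
Lemma average_cosets A U S k l :
    {in A & U, forall a g, a * g \in U} ->
    {in U, forall g, k * #|S :&: A :* g| <= l} ->
  k * (#|A| * #|S :&: U|) <= l * #|U|.
Proof.
move=> AU le_l; rewrite -sum_card_cosets // big_distrr /=.
rewrite mulnC -sum_nat_const; exact: leq_sum.
Qed.

Lemma central_comm G z g : z \in 'Z(G) -> g \in G -> z * g = g * z.
Proof. by case/centerP=> _ cz Gg; apply: cz. Qed.

Lemma comm_sqr_trivial g (k : gT) :
  commute [~ g, k] g -> commute (g ^+ 2) k -> [~ g, k] ^+ 2 = 1.
Proof.
move=> cg ck; have gJ : [~ g, k] ^ g = [~ g, k] by apply/conjg_fixP/commgP.
by rewrite expgS expg1 -{1}gJ -commMgJ; apply/eqP/commgP.
Qed.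

Lemma comm_swap g (k : gT) : [~ g, k] ^+ 2 = 1 -> [~ k, g] = [~ g, k].
Proof.
move=> c2; rewrite -invg_comm; apply: (mulgI [~ g, k]).
by rewrite mulgV -c2 expgS expg1.
Qed.

(** Modulo a central subgroup W, commutation with s is a homomorphism; so it is
    enough to check on generators that commutators fall into W. *)
Lemma comm_central_group_set G S W :
    S \subset G -> W \subset 'Z(G) -> group_set W ->
  group_set [set g in G | [forall s in S, [~ s, g] \in W]].
Proof.
move=> sSG sWZ gW; pose V := Group gW; have WV : W = V by [].
apply/group_setP; split.
  by apply/setIdP; split; [exact: group1 | apply/forall_inP=> s _; rewrite commg1 WV group1].
move=> g k /setIdP[Gg /forall_inP cg] /setIdP[Gk /forall_inP ck].
apply/setIdP; split; first exact: groupM.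
apply/forall_inP=> s Ss; rewrite commgMJ.
have -> : [~ s, g] ^ k = [~ s, g].
  apply/conjg_fixP/commgP; apply: central_comm Gk.
  by apply: (subsetP sWZ); apply: cg.
by rewrite WV groupM // -WV; [apply: ck | apply: cg].
Qed.

End Generalities.

(** * Elements that an automorphism sends to their cubes *)

Section CubedElements.

Variables (gT : finGroupType) (G : {group gT}) (alpha : {perm gT}).
Hypothesis autG : alpha \in Aut G.
Implicit Types (x y h g a b : gT) (A B H K : {group gT}).

Local Notation T := (cubed_set G alpha).

Lemma aut_mul : {in G &, {morph alpha : x y / x * y}}.
Proof. exact: (morphicP (Aut_morphic autG)). Qed.

Lemma aut_one : alpha 1 = 1.
Proof. by apply: (mulgI (alpha 1)); rewrite -aut_mul ?group1 // !mulg1. Qed.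

Lemma aut_exp x n : x \in G -> alpha (x ^+ n) = alpha x ^+ n.
Proof.
move=> Gx; elim: n => [|n IHn]; first by rewrite !expg0 aut_one.
by rewrite !expgS aut_mul ?groupX // IHn.
Qed.

Lemma aut_inv x : x \in G -> alpha x^-1 = (alpha x)^-1.
Proof.
move=> Gx; apply: (mulgI (alpha x)).
by rewrite -aut_mul ?groupV // !mulgV aut_one.
Qed.

Lemma aut_conj x y : x \in G -> y \in G -> alpha (x ^ y) = alpha x ^ alpha y.
Proof. by move=> Gx Gy; rewrite !conjgE !aut_mul ?groupM ?groupV // aut_inv. Qed.

Lemma cubedP x : reflect (x \in G /\ alpha x = x ^+ 3) (x \in T).
Proof. by rewrite inE; apply: (iffP andP) => -[Gx /eqP]. Qed.

Lemma cubed_in x : x \in T -> x \in G.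
Proof. by case/cubedP. Qed.

Lemma cubed_aut x : x \in T -> alpha x = x ^+ 3.
Proof. by case/cubedP. Qed.

Lemma cubed_subset : T \subset G.
Proof. by apply/subsetP=> x /cubed_in. Qed.

Lemma cubed_one : 1 \in T.
Proof. by rewrite inE group1 aut_one expg1n eqxx. Qed.

Lemma cubed_exp x n : x \in T -> x ^+ n \in T.
Proof.
case/cubedP=> Gx ax; apply/cubedP; split; first exact: groupX.
by rewrite aut_exp // ax -!expgM mulnC.
Qed.

Lemma cubed_inv x : (x^-1 \in T) = (x \in T).
Proof.
suff sub y : y \in T -> y^-1 \in T.
  by apply/idP/idP=> [/sub|/sub //]; rewrite invgK.
case/cubedP=> Gy ay; apply/cubedP; split; first by rewrite groupV.
by rewrite aut_inv // ay expgVn.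
Qed.

(** An element of order 3 would lie in the kernel of cubing, that is, of
    alpha; so cubing is invertible on the powers of a cubed element. *)
Lemma cubed_coprime x : x \in T -> coprime #[x] 3.
Proof.
move=> Tx; rewrite coprime_sym prime_coprime //; apply/negP=> /dvdnP[m ox].
have Tm : x ^+ m \in T by apply: cubed_exp.
have am : alpha (x ^+ m) = alpha 1.
  by rewrite (cubed_aut Tm) aut_one -expgM -ox expg_order.
have /eqP := perm_inj am; rewrite -order_dvdn ox => dv.
have m0 : 0 < m by case: m ox {Tm am dv} => //=; have := order_gt0 x; case: #[x].
have := dvdn_leq m0 dv; rewrite leqNgt => /negP[].
by rewrite -[X in X < _]muln1 ltn_pmul2l.
Qed.

(** For x, y and x y cubed, alpha (x y) = x^3 y^3 = (x y)^3 loses one letter at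
    each end. *)
Lemma cubed_mul x y :
  x \in T -> y \in T -> (x * y \in T) = ((y * x) ^+ 2 == x ^+ 2 * y ^+ 2).
Proof.
move=> Tx Ty; rewrite inE groupM ?cubed_in //= aut_mul ?cubed_in // !cubed_aut //.
have -> : (x * y) ^+ 3 = x * (y * x) ^+ 2 * y by rewrite !expgS !expg0 !mulg1 !mulgA.
have -> : x ^+ 3 * y ^+ 3 = x * (x ^+ 2 * y ^+ 2) * y.
  by rewrite !expgS !expg0 !mulg1 !mulgA.
by rewrite (inj_eq (mulIg y)) (inj_eq (mulgI x)) eq_sym.
Qed.

Lemma cubed_mul_comm x y : x \in T -> y \in T -> commute x y -> x * y \in T.
Proof. by move=> Tx Ty cxy; rewrite cubed_mul // -cxy expgMn. Qed.

(** Conjugation by h becomes conjugation by h^3 under alpha, so a cubed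
    conjugate x ^ h forces h^2 to commute with x^3, hence with x. *)
Lemma cubed_conj x h :
  x \in T -> h \in T -> (x ^ h \in T) = (h ^+ 2 \in 'C[x]).
Proof.
move=> Tx Th; rewrite inE groupJ ?cubed_in //= aut_conj ?cubed_in // !cubed_aut //.
have Gx := cubed_in Tx; have hx: coprime #[x] 3 := cubed_coprime Tx.
rewrite -conjXg (expgSr h 2) conjgM (inj_eq (conjg_inj h)).
rewrite (sameP eqP conjg_fixP).
apply/commgP/cent1P=> [/cent1P cx | cx].
  by apply/cent1P; rewrite cent1C; apply: coprime_root_in hx cx.
exact/commute_sym/commuteX.
Qed.

(** Put a = h and let b, c, d be its successive conjugates by y.  The hypotheses
    on products read c b = a^2 and d^2 = b c.  With t = a^-1 b they give
    t^a = t^2 and t^5 = 1, and the conjugates are b = a t, c = a t^2, d = a t^3.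
    Then alpha fixes t, so applying it to t^a = t^2 yields t^(a^3) = t^2, while
    t^(a^3) = t^8 = t^3.  Hence t = 1. *)
Lemma interleaved_relations h y :
    h \in T -> y \in T -> y * h \in T -> h^-1 * y \in T ->
    commute (h ^+ 4) y -> commute h y.
Proof.
move=> Th Ty Tyh Thy c4; have Gh := cubed_in Th; have Gy := cubed_in Ty.
have [b bE] : {b | h ^ y = b} by exists (h ^ y).
have [c cE] : {c | b ^ y = c} by exists (b ^ y).
have [d dE] : {d | c ^ y = d} by exists (c ^ y).
have Ecb : c * b = h ^+ 2.
  move: Tyh; rewrite cubed_mul // => /eqP E.
  rewrite -(mulKg (y ^+ 2) (h ^+ 2)) -E -cE -bE; by reduce_words.
have Edd : d ^+ 2 = b * c.
  move: Thy; rewrite cubed_mul ?cubed_inv // => /eqP E.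
  have {}E : h ^+ 2 = (y ^+ 2 * h * y^-1) * (h * y^-1).
    have -> : h ^+ 2 = (h^-1 ^+ 2 * y ^+ 2 * (y ^+ 2)^-1)^-1 by reduce_words.
    by rewrite -E; reduce_words.
  rewrite -dE -cE -bE -!conjXg E; by reduce_words.
have Eb4 : b ^+ 4 = h ^+ 4 by rewrite -bE -conjXg; apply/conjg_fixP/commgP.
have Edc : d * c = b ^+ 2 by rewrite -bE -conjXg -Ecb conjMg cE dE.
have Ec : c = h ^+ 2 * b^-1 by rewrite -Ecb mulgK.
have Ed : d = b^-1 * h ^+ 2.
  have -> : d = b ^+ 2 * c^-1 by rewrite -Edc mulgK.
  apply: (mulgI b); apply: (mulIg (h ^+ 2)).
  have -> : b * (b ^+ 2 * c^-1) * h ^+ 2 = b ^+ 4 by rewrite Ec; reduce_words.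
  by rewrite Eb4; reduce_words.
have Ecbh : c = b ^ h.
  apply: (conjg_inj y); rewrite dE conjJg bE cE Ed Ec; by reduce_words.
have R1 : b * h * b = h ^+ 3.
  have -> : h ^+ 3 = h * c * b by rewrite Ec; reduce_words.
  by rewrite Ecbh; reduce_words.
have R2 : h^-1 * b ^+ 2 * h = h * b.
  apply: (conjg_inj y); rewrite [RHS]conjMg bE cE -Edd -dE -conjXg Ecbh.
  by congr (_ ^ y); reduce_words.
have [t Eb] : {t | b = h * t} by exists (h^-1 * b); rewrite mulKVg.
have tA2 : t ^ (h ^+ 2) = t^-1.
  have E : h ^+ 2 = t * h ^+ 2 * t.
    by apply: (mulgI h); rewrite -expgS -R1 Eb; reduce_words.
  by apply: (mulIg t); apply: (mulgI (h ^+ 2)); rewrite mulVg mulg1 {3}E; reduce_words.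
have tA : t ^ h = t ^+ 2.
  have E : h ^+ 2 * t = t * h * t * h.
    apply: (mulgI h); have -> : h * (h ^+ 2 * t) = h * (h * b) by rewrite Eb; reduce_words.
    by rewrite -R2 Eb; reduce_words.
  apply: (mulgI t^-1); rewrite -{1}tA2.
  have -> : t ^ (h ^+ 2) * t ^ h = h ^- 2 * (t * h * t * h) by reduce_words.
  by rewrite -E; reduce_words.
have tJ n k : (t ^+ n) ^ (h ^+ k) = t ^+ (n * 2 ^ k).
  elim: k n => [|k IHk] n; first by rewrite conjg1 muln1.
  by rewrite expgS conjgM conjXg tA -expgM IHk (mulnC 2) -mulnA -expnS.
have t5 : t ^+ 5 = 1.
  by have := tJ 1%N 2; rewrite expg1 tA2 mul1n (expgSr t 4) => <-; rewrite mulVg.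
have Ed3 : d = h * t ^+ 3.
  have E : t^-1 ^ h = t ^+ 3.
    apply: (mulgI (t ^+ 2)); rewrite -expgD t5 -tA -conjMg mulgV.
    by rewrite conj1g.
  by rewrite -E Ed Eb; reduce_words.
have at_t : alpha t = t.
  have Gb : b \in G by rewrite -bE groupJ.
  have Et : t = h^-1 * b by rewrite Eb mulKg.
  have ab : alpha b = d ^+ 3.
    rewrite -bE aut_conj // !cubed_aut // -dE -cE -bE -!conjgM conjXg.
    by rewrite !expgS expg0 mulg1 mulgA.
  have E3 : d ^+ 3 = h ^+ 3 * (t ^+ 3 ^ h ^+ 2 * t ^+ 3 ^ h ^+ 1 * t ^+ 3).
    by rewrite Ed3; reduce_words.
  rewrite Et aut_mul ?groupV // aut_inv // (cubed_aut Th) ab E3 mulKg !tJ.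
  rewrite -!expgD -Et.
  by rewrite -[RHS]mulg1 -[in RHS](expg1n _ 4) -t5 -expgM -expgS.
have Gt : t \in G by rewrite -(groupMl _ Gh) -Eb -bE groupJ.
have t1 : t = 1.
  have := congr1 alpha tA; rewrite aut_conj // (cubed_aut Th) aut_exp // at_t.
  have := tJ 1%N 3; rewrite expg1 => -> E.
  apply: (mulgI (t ^+ 2)); rewrite mulg1 -expgSr -E.
  by rewrite -[LHS]mulg1 -t5 -expgD.
by apply/commgP/conjg_fixP; rewrite bE Eb t1 mulg1.
Qed.

(** The conjugates b and c of h by y^-1 and y^-2 satisfy b c = c b = h^2.  So b
    commutes with h, and c^2 = b^-2 h^4 = b^2. *)
Lemma parallel_relations h y :
    h \in T -> y \in T -> h * y \in T -> h^-1 * y \in T ->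
    commute (h ^+ 4) y -> commute (h ^+ 2) y.
Proof.
move=> Th Ty Thy Thy' c4.
have [b bE] : {b | h ^ y^-1 = b} by exists (h ^ y^-1).
have [c cE] : {c | b ^ y^-1 = c} by exists (b ^ y^-1).
have Ebc : b * c = h ^+ 2.
  move: Thy; rewrite cubed_mul // => /eqP E.
  rewrite -(mulgK (y ^+ 2) (h ^+ 2)) -E -cE -bE; by reduce_words.
have Ecb : c * b = h ^+ 2.
  move: Thy'; rewrite cubed_mul ?cubed_inv // => /eqP E; apply: invg_inj.
  rewrite -[in RHS]expgVn -(mulgK (y ^+ 2) (h^-1 ^+ 2)) -E -cE -bE; by reduce_words.
have cbh : commute b h.
  by apply: (conjg_inj y^-1); rewrite !conjMg cE bE Ecb Ebc.
have Eb4 : b ^+ 4 = h ^+ 4.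
  by rewrite -bE -conjXg; apply/conjg_fixP/commgP/commuteV.
have Eh : b ^+ 2 = h ^+ 2.
  apply: (conjg_inj y^-1); rewrite !conjXg bE cE -(mulKg b c) Ebc.
  have cbh2 : commute b^-1 (h ^+ 2) by apply/commuteX/commute_sym/commuteV/commute_sym.
  by rewrite expgMn // -expgM -Eb4; reduce_words.
rewrite -[y]invgK; apply: commuteV; apply/commgP/conjg_fixP.
by rewrite conjXg bE Eh.
Qed.

(** Replacing h or y by its inverse reduces the four combinations of the
    hypotheses to the two preceding lemmas. *)
Lemma four_term_obstruction h y :
    h \in T -> y \in T -> commute (h ^+ 4) y ->
    (h * y \in T) || (y * h \in T) -> (h^-1 * y \in T) || (y * h^-1 \in T) ->
  commute (h ^+ 2) y.
Proof.
move=> Th Ty c4 /orP[Thy | Tyh] /orP[Thy' | Tyh'].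
- exact: parallel_relations.
- apply/commute_sym/commuteX/commute_sym; rewrite -[h]invgK; apply/commute_sym/commuteV/commute_sym.
  apply: interleaved_relations; rewrite ?invgK ?cubed_inv // expgVn.
  exact/commute_sym/commuteV/commute_sym.
- by apply/commute_sym/commuteX/commute_sym; apply: interleaved_relations.
- rewrite -[y]invgK; apply: commuteV; apply: parallel_relations; rewrite ?cubed_inv //.
  + by rewrite -cubed_inv invMg invgK.
  + by rewrite -cubed_inv invMg !invgK.
  exact: commuteV.
Qed.

(** * Conjugation by powers of a cubed element *)

Section CyclicOrbits.

Variable h : gT.
Hypothesis Th : h \in T.

Let orbit_hits g := #|[set v in <[h]> | g ^ v \in T]|.

(** For a cubed g, these are the v in <h> for which g ^ v is cubed. *)
Definition square_commuting g : {set gT} := [set v in <[h]> | v ^+ 2 \in 'C[g]].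

Lemma mem_square_commuting g u :
  (u \in square_commuting g) = (u \in <[h]>) && (u ^+ 2 \in 'C[g]).
Proof. exact: in_set. Qed.

Lemma square_commuting_group_set g : group_set (square_commuting g).
Proof.
apply/group_setP; split; first by rewrite inE group1 expg1n group1.
move=> u v /setIdP[hu Cu] /setIdP[hv Cv]; apply/setIdP; split; first exact: groupM.
have cuv : commute u v := centsP (cycle_abelian h) _ hu _ hv.
by rewrite (expgMn _ cuv); apply: groupM.
Qed.
Canonical square_commuting_group g := Group (square_commuting_group_set g).

Lemma cycle_cubed v : v \in <[h]> -> v \in T.
Proof. by case/cycleP=> n ->; apply: cubed_exp. Qed.

Lemma cycle_comm u v : u \in <[h]> -> v \in <[h]> -> commute u v.
Proof. by move=> hu hv; apply: (centsP (cycle_abelian h) _ hu _ hv). Qed.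

Lemma square_commuting_sub g : square_commuting g \subset <[h]>.
Proof. by apply/subsetP=> v; rewrite inE => /andP[]. Qed.

Lemma square_commutingJ g v : v \in <[h]> -> square_commuting (g ^ v) = square_commuting g.
Proof.
move=> hv; apply/setP=> u; rewrite !mem_square_commuting; case hu: (u \in <[h]>) => //=.
have uv : (u ^+ 2) ^ v = u ^+ 2 by apply/conjg_fixP/commgP/cycle_comm=> //; apply: groupX.
by rewrite -[in LHS]uv; apply/cent1P/cent1P; rewrite /commute -!conjMg;
  [apply: conjg_inj | move=> ->].
Qed.

Lemma square_commutingM g w : w \in <[h]> -> square_commuting (w * g) = square_commuting g.
Proof.
move=> hw; apply/setP=> u; rewrite !mem_square_commuting; case hu: (u \in <[h]>) => //=.
have cuw : u ^+ 2 \in 'C[w] by apply/cent1P/cycle_comm=> //; apply: groupX.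
rewrite ![u ^+ 2 \in _]cent1C in cuw *; by rewrite groupMl.
Qed.

Lemma cubed_cycleJ x v :
  x \in T -> v \in <[h]> -> (x ^ v \in T) = (v \in square_commuting x).
Proof. by move=> Tx hv; rewrite cubed_conj // ?mem_square_commuting ?hv ?cycle_cubed. Qed.

(** Two elements of <h> that conjugate g into T lie in the same coset of
    square_commuting g. *)
Lemma orbit_hits_le g : orbit_hits g <= #|square_commuting g|.
Proof.
rewrite /orbit_hits; case: (set_0Vmem [set v in <[h]> | g ^ v \in T]) => [-> | [v0]].
  by rewrite cards0.
rewrite inE => /andP[hv0 Tg0]; rewrite -(card_lcoset _ v0).
apply/subset_leq_card/subsetP=> v; rewrite inE mem_lcoset => /andP[hv Tgv].
rewrite -(square_commutingJ g hv0) -cubed_cycleJ ?groupM ?groupV //.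
by rewrite -conjgM mulKVg.
Qed.

Lemma orbit_hits_period g :
  h ^+ 4 \in 'C[g] -> orbit_hits (h ^+ 4 * g) = orbit_hits g.
Proof.
move=> cg; apply: eq_card => v; rewrite [LHS]in_set [RHS]in_set.
case hv: (v \in <[h]>) => //=.
have hJ : (h ^+ 4) ^ v = h ^+ 4.
  by apply/conjg_fixP/commgP/cycle_comm=> //; apply/mem_cycle.
have cgv : commute (h ^+ 4) (g ^ v) by rewrite -hJ /commute -!conjMg (cent1P cg).
have T4 : h ^+ 4 \in T by apply: cubed_exp.
rewrite conjMg hJ; apply/idP/idP=> [Thg | Tg]; last exact: cubed_mul_comm.
rewrite -(mulKg (h ^+ 4) (g ^ v)); apply: cubed_mul_comm; rewrite ?cubed_inv //.
by apply/commute_sym/commuteV/commute_sym/commuteM.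
Qed.

(** If square_commuting g has index 2 in <h>, every conjugate of h^i g by an
    element of <h> is in T exactly when h^i g is, or exactly when (h^i g)^h is,
    once g itself is moved into T.  As h^4 commutes with g, h^3 g plays the part
    of h^-1 g, and the three hits contradict four_term_obstruction. *)
Lemma no_three_hits g :
    g \in G -> #|<[h]> : square_commuting g| = 2 -> h \notin square_commuting g ->
    orbit_hits g != 0 -> orbit_hits (h * g) != 0 -> orbit_hits (h ^+ 3 * g) != 0 ->
  False.
Proof.
move=> Gg i2 nQh.
have hh : h \in <[h]> := cycle_id h.
have sQ := square_commuting_sub g.
have Q2 : h ^+ 2 \in square_commuting g by rewrite expgS expg1 (index2_mul sQ) // eqxx.
have c4 : h ^+ 4 \in 'C[g] by move: Q2; rewrite mem_square_commuting -expgM => /andP[].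
rewrite -!lt0n !card_gt0.
case/set0Pn=> v0; rewrite inE => /andP[hv0].
have [y yE] : {y | g ^ v0 = y} by exists (g ^ v0).
rewrite yE => Ty.
have Qy : square_commuting y = square_commuting g by rewrite -yE square_commutingJ.
have c4y : commute (h ^+ 4) y.
  have <- : (h ^+ 4) ^ v0 = h ^+ 4.
    by apply/conjg_fixP/commgP/cycle_comm=> //; apply/mem_cycle.
  by rewrite /commute -yE -!conjMg (cent1P c4).
have shift w : w \in <[h]> -> [set v in <[h]> | (w * g) ^ v \in T] != set0 ->
    (w * y \in T) || ((w * y) ^ h \in T).
  move=> hw /set0Pn[v]; rewrite inE => /andP[hv].
  have -> : (w * g) ^ v = (w * y) ^ (v0^-1 * v).
    rewrite conjgM; congr (_ ^ _); rewrite conjMg -yE conjgK.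
    by congr (_ * _); apply/esym/conjg_fixP/commgP/cycle_comm=> //; apply: groupVr.
  have: v0^-1 * v \in <[h]> by rewrite groupM ?groupV.
  move: (v0^-1 * v) => u hu Tu.
  have Qwy x : x \in <[h]> -> square_commuting ((w * y) ^ x) = square_commuting g.
    by move=> hx; rewrite square_commutingJ // square_commutingM.
  have [Qu | nQu] := boolP (u \in square_commuting g).
    apply/orP; left; rewrite -(conjgK u (w * y)) cubed_cycleJ ?(groupV <[h]>) //.
    by rewrite Qwy // groupV.
  apply/orP; right; rewrite -(mulKVg u h) conjgM cubed_cycleJ //.
    by rewrite Qwy // (index2_mul sQ) ?(groupV <[h]>) // groupV (negPf nQh) (negPf nQu).
  by rewrite groupM ?groupV.
move=> /(shift h hh) Hh /(shift _ (mem_cycle h 3)) H3.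
move: nQh; rewrite -Qy mem_square_commuting hh andTb => /cent1P[].
apply: four_term_obstruction => //.
  case/orP: Hh => [-> // | Hh]; apply/orP; right.
  by have -> : y * h = (h * y) ^ h by reduce_words.
have T4 : h ^- 4 \in T by rewrite cubed_inv cubed_exp.
have hi : h^-1 = h ^- 4 * h ^+ 3 by reduce_words.
have lower z : commute (h ^+ 4) z -> h ^+ 3 * z \in T -> h^-1 * z \in T.
  move=> cz Tz; rewrite hi -mulgA; apply: cubed_mul_comm => //.
  apply/commute_sym/commuteV; apply: commute_sym; apply: commuteM => //.
  exact: commuteX2.
case/orP: H3 => [/(lower _ c4y) -> // | H3]; apply/orP; right.
have hJ : h ^ h = h by apply/conjg_fixP/commgP.
have : h ^+ 3 * y ^ h \in T.
  by move: H3; rewrite conjMg conjXg hJ.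
have c4yh : commute (h ^+ 4) (y ^ h).
  have <- : (h ^+ 4) ^ h = h ^+ 4 by rewrite conjXg hJ.
  by rewrite /commute -!conjMg c4y.
move/(lower _ c4yh) => Ty'.
have -> : y * h^-1 = (h^-1 * y ^ h) ^ (h ^- 2) by reduce_words.
rewrite cubed_conj ?cubed_inv ?cubed_exp // expgVn -expgM groupV.
apply/cent1P; apply: commuteM => //; apply: commuteV.
exact/commute_sym/commuteX.
Qed.

(** The index of square_commuting g in <h> is not 1 as h^2 does not commute with
    g, and not 3 as the order of h is prime to 3.  If it is at least 4 each term
    is at most a quarter of the order of h.  If it is 2, each term is at most a
    half, and at most two of four cyclically consecutive terms are nonzero. *)
Lemma orbit_hits_sum g :
    g \in G -> h ^+ 2 \notin 'C[g] ->
  \sum_(i < 4) orbit_hits (h ^+ i * g) <= #[h].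
Proof.
move=> Gg nCh; have sQ := square_commuting_sub g.
have hX i : h ^+ i \in <[h]> by apply: mem_cycle.
have Gh := cubed_in Th.
have nQh : h \notin square_commuting g.
  by rewrite mem_square_commuting negb_and nCh orbT.
have hits_le i : orbit_hits (h ^+ i * g) <= #|square_commuting g|.
  by rewrite -(square_commutingM g (hX i)) orbit_hits_le.
have := Lagrange sQ; set q := #|square_commuting g| in hits_le *.
set m := #|_ : _| => Eqm; rewrite -orderE in Eqm.
rewrite !big_ord_recr big_ord0 /= add0n.
 move: (hits_le 0) (hits_le 1%N) (hits_le 2) (hits_le 3).
have m0 : m != 0 by apply/eqP=> m0; move: Eqm (order_gt0 h); rewrite m0 muln0 => <-.
have m1 : m != 1%N.
  apply: contra nQh => /eqP m1; have /eqP := index1g sQ m1.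
  by rewrite eqEsubset => /andP[_ /subsetP->] //; apply: cycle_id.
have m3 : m != 3.
  apply/eqP=> m3; have := cubed_coprime Th; rewrite -Eqm m3 coprimeMl.
  by rewrite andbC.
have [m4 | m4] := leqP 4 m.
  by move=> l0 l1 l2 l3; have := leq_mul (leqnn q) m4; lia.
have m2 : m = 2 by move: m m0 m1 m3 m4 {Eqm} => [|[|[|[|]]]].
have Q2 : h ^+ 2 \in square_commuting g by rewrite expgS expg1 (index2_mul sQ) ?cycle_id // eqxx.
have c4 : h ^+ 4 \in 'C[g] by move: Q2; rewrite mem_square_commuting -expgM => /andP[].
have period i : orbit_hits (h ^+ (i + 4) * g) = orbit_hits (h ^+ i * g).
  rewrite addnC expgD -mulgA; apply: orbit_hits_period; apply/cent1P.
  by apply: commuteM; [exact: commuteX2 | exact/cent1P].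
have three i : orbit_hits (h ^+ i * g) != 0 -> orbit_hits (h ^+ i.+1 * g) != 0 ->
    orbit_hits (h ^+ (i + 3) * g) != 0 -> False.
  move=> n0; rewrite expgS -mulgA => n1; rewrite addnC expgD -mulgA => n3.
  apply: (no_three_hits _ _ _ n0 n1 n3); first by rewrite groupM ?groupX.
    by rewrite square_commutingM.
  by rewrite square_commutingM.
move: (three 0) (three 1%N) (three 2) (three 3).
have p0 := period 0; have p1 := period 1%N; have p2 := period 2.
rewrite !add1n !add0n /= in p0 p1 p2; rewrite p0 p1 p2.
rewrite -Eqm m2; move: (orbit_hits _) (orbit_hits _) (orbit_hits _) (orbit_hits _).
move=> [|n0] [|n1] [|n2] [|n3] // t0 t1 t2 t3 l0 l1 l2 l3; rewrite muln2 -addnn; try by lia.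
all: by exfalso; (apply: t0 || apply: t1 || apply: t2 || apply: t3).
Qed.

(** Translations and conjugations by <h> permute B - C(h^2), so averaging the
    preceding bound over this set gives the density of T in it. *)
Lemma cubed_outside_square_centralizer (B : {group gT}) :
    B \subset G -> h \in B ->
  4 * #|T :&: (B :\: 'C[h ^+ 2])| <= #|B :\: 'C[h ^+ 2]|.
Proof.
move=> sBG Bh; set U := B :\: _.
have UE g : (g \in U) = (g \notin 'C[h ^+ 2]) && (g \in B) by rewrite inE.
have hU w g : w \in <[h]> -> (w * g \in U) = (g \in U).
  move=> hw; rewrite !UE; have Bw : w \in B by apply: subsetP hw; rewrite cycle_subG.
  have Cw : w \in 'C[h ^+ 2] by apply/cent1P/cycle_comm=> //; apply: mem_cycle.
  by rewrite !groupMl.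
have hUJ w g : w \in <[h]> -> g \in U -> g ^ w \in U.
  move=> hw Ug; rewrite conjgE hU ?groupV //.
  rewrite !UE in Ug *; have Bw : w \in B by apply: subsetP hw; rewrite cycle_subG.
  have Cw : w \in 'C[h ^+ 2] by apply/cent1P/cycle_comm=> //; apply: mem_cycle.
  by rewrite !groupMr.
have bound g : g \in U -> \sum_(i < 4) orbit_hits (h ^+ i * g) <= #[h].
  move=> Ug; apply: orbit_hits_sum.
    by apply: (subsetP sBG); move: Ug; rewrite UE => /andP[].
  by move: Ug; rewrite UE cent1C => /andP[].
rewrite -(leq_pmul2l (order_gt0 h)) (mulnC #[h] #|U|).
have : (\sum_(g in U) \sum_(i < 4) orbit_hits (h ^+ i * g) <= \sum_(g in U) #[h])%N.
  exact: leq_sum.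
rewrite sum_nat_const; apply: leq_trans; rewrite exchange_big /=.
rewrite (eq_bigr (fun=> (#[h] * #|T :&: U|)%N)) => [|i _]; last first.
  rewrite (eq_bigr (fun g => \sum_(v in <[h]>) ((h ^+ i * g) ^ v \in T)%g)) => [|g _].
    rewrite exchange_big /= (eq_bigr (fun=> #|T :&: U|)) => [|v hv].
      by rewrite sum_nat_const -orderE.
    rewrite -big_mkcondr /= sum1dep_card setIC.
    rewrite -(@card_preim_stable _ (fun g => (h ^+ i * g) ^ v)) //.
      by move=> x y /conjg_inj/mulgI.
    by move=> g Ug; rewrite hUJ // hU ?mem_cycle.
  by rewrite /orbit_hits -sum1dep_card big_mkcondr.
by rewrite sum_nat_const card_ord mulnCA mulnA.
Qed.

End CyclicOrbits.

End CubedElements.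

(** * An abelian subgroup of index two *)

Section AbelianIndexTwo.

Variable gT : finGroupType.
Implicit Types (G H K : {group gT}) (U S : {set gT}).

(** A Sylow 3-subgroup of K is one of G, because K has index 2, and it is
    characteristic in the normal abelian subgroup K.  It meets Z(G) trivially
    because the orders are coprime. *)
Lemma structureII_index2 G K :
    ~~ abelian G -> K \subset G -> #|G : K| = 2 -> abelian K ->
  coprime #|'Z(G)| 3 -> structureII G.
Proof.
move=> nabG sKG iGK abK coZ; split=> //; exists 'O_3(K)%G.
have nKG : K <| G by apply: index2_normal.
have nSG : 'O_3(K) <| G := char_normal_trans (pcore_char 3 K) nKG.
have hallS := nilpotent_pcore_Hall 3 (abelian_nil abK).
split=> //; first 1 last.
- by exists K; split=> //; apply: pcore_sub.
- apply: coprime_TIg; apply: pnat_coprime (pcore_pgroup 3 K) _.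
  by rewrite p'natE // -prime_coprime // coprime_sym.
rewrite pHallE; apply/andP; split; first exact: normal_sub.
rewrite -(Lagrange sKG) iGK partnM // (card_Hall hallS).
by rewrite [X in (_ * X)%N]part_p'nat // muln1.
Qed.

End AbelianIndexTwo.

(** * Cubed elements with noncentral squares *)

Section CubedFraction.

Variables (gT : finGroupType) (G : {group gT}) (alpha : {perm gT}).
Hypothesis autG : alpha \in Aut G.
Implicit Types (x y h g a b : gT) (A B H K : {group gT}).

Local Notation T := (cubed_set G alpha).

(** The sets T and z T must meet inside B, so b = z c with b and c cubed, and
    alpha z = z^3 follows by cancellation. *)
Lemma central_cubed B z :
  B \subset G -> #|B| < 2 * #|T :&: B| -> z \in 'Z(B) -> z \in T.
Proof.
move=> sBG ltB /centerP[Bz cBz].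
have szB : z *: (T :&: B) \subset B.
  by apply/subsetP=> _ /lcosetP[b /setIP[_ Bb] ->]; rewrite groupM.
have lt2 : #|B| < #|T :&: B| + #|z *: (T :&: B)| by rewrite card_lcoset addnn -mul2n.
have [b] := subsets_meet (subsetIr T B) szB lt2.
case/setIP=> Tb Bb /lcosetP[c /setIP[Tc Bc] bE].
have Gz := subsetP sBG _ Bz; apply/cubedP=> //; split=> //.
have := cubed_aut Tb; rewrite bE (aut_mul autG) ?(cubed_in Tc) // (cubed_aut Tc).
by rewrite expgMn; [move/mulIg | apply: cBz].
Qed.

Lemma cubed_group_coprime B : B \subset T -> coprime #|B| 3.
Proof.
move=> sBT; rewrite coprime_sym prime_coprime //; apply/negP=> /Cauchy[] // x Bx ox.
by have := cubed_coprime autG (subsetP sBT _ Bx); rewrite ox.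
Qed.

Lemma center_cubed B :
  B \subset G -> #|B| < 2 * #|T :&: B| -> 'Z(B) \subset T.
Proof. by move=> sBG ltB; apply/subsetP=> z; apply: central_cubed ltB. Qed.

Lemma card_cubed_split B h :
    B \subset G -> h \in T -> h \in B ->
  4 * #|T :&: B| + #|'C_B[h ^+ 2]| <= #|B| + 4 * #|T :&: 'C_B[h ^+ 2]|.
Proof.
move=> sBG Th Bh.
have := cubed_outside_square_centralizer autG Th sBG Bh.
have := cardsID 'C[h ^+ 2] B; have := cardsID 'C[h ^+ 2] (T :&: B).
by rewrite -setIDA -setIA; card_lia.
Qed.

(** When the square of x y is central, (x y)^2 and (y x)^2 agree and the
    relation x^2 y^2 = (y x)^2 collapses to commutation. *)
Lemma cubed_mul_commute x y :
    x \in T -> y \in T -> x * y \in T -> commute ((x * y) ^+ 2) x -> commute x y.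
Proof.
move=> Tx Ty; rewrite cubed_mul // => /eqP E c2; apply/commute_sym.
have Exy : (x * y) ^+ 2 = x ^+ 2 * y ^+ 2.
  rewrite -E; apply: (mulgI x); rewrite -c2; by reduce_words.
apply: (mulgI x); apply: (mulIg y).
have -> : x * (y * x) * y = (x * y) ^+ 2 by reduce_words.
by rewrite Exy; reduce_words.
Qed.

(** A cubed h with square not central in B would leave T a density of at most
    1/2 + 1/8 in B.  So squares of cubed elements are central in B; then a cubed
    x commutes with every y such that y and x y are cubed, which is more than
    half of B. *)
Lemma three_quarters_abelian B :
  B \subset G -> 3 * #|B| < 4 * #|T :&: B| -> abelian B.
Proof.
move=> sBG ltB.
have sqC h : h \in T :&: B -> h ^+ 2 \in 'Z(B).
  case/setIP=> Th Bh; have := card_cubed_split sBG Th Bh.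
  have sCB : 'C_B[h ^+ 2] \subset B := subsetIl _ _.
  have: #|T :&: 'C_B[h ^+ 2]| <= #|'C_B[h ^+ 2]| by rewrite subset_leq_card ?subsetIr.
  move=> leC leT; have eqC : 'C_B[h ^+ 2] = B.
    by apply: (large_subgroup sCB); card_lia.
  apply/centerP; split=> [|b Bb]; first exact: groupX.
  by apply/cent1P; rewrite cent1C; move: Bb; rewrite -{1}eqC inE => /andP[].
have TBZ : T :&: B \subset 'Z(B).
  apply/subsetP=> x TBx; have /setIP[Tx Bx] := TBx.
  have sCB : 'C_B[x] \subset B := subsetIl _ _.
  have eqC : 'C_B[x] = B.
    apply: (large_subgroup sCB).
    pose S := (x^-1 *: (T :&: B)) :&: (T :&: B).
    have sS : S \subset 'C_B[x].
      apply/subsetP=> y /setIP[]; rewrite mem_lcoset invgK => /setIP[Txy Bxy] /setIP[Ty By].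
      rewrite inE By; apply/cent1P/commute_sym.
      apply: cubed_mul_commute => //.
      have /sqC/centerP[_ cxy] : x * y \in T :&: B by rewrite inE Txy.
      exact: cxy.
    have cS : #|B| < 2 * #|S|.
      have := cardsUI (x^-1 *: (T :&: B)) (T :&: B); rewrite card_lcoset -/S.
      have : #|x^-1 *: (T :&: B) :|: T :&: B| <= #|B|.
        rewrite subset_leq_card // subUset subsetIr andbT.
        apply/subsetP=> z; rewrite mem_lcoset invgK => /setIP[_].
        by rewrite groupMl.
      by card_lia.
    by apply: leq_trans cS _; rewrite leq_mul2l subset_leq_card.
  apply/centerP; split=> // b Bb.
  by apply/cent1P; rewrite cent1C; move: Bb; rewrite -{1}eqC inE => /andP[].
have -> : abelian B = ('Z(B) == B) by apply/idP/eqP => /center_idP.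
by apply/eqP/(large_subgroup (center_sub B)); have := subset_leq_card TBZ; card_lia.
Qed.

(** At most a quarter of the elements outside C(h^2) are cubed, which forces
    C(h^2) to have index 2 and more than three quarters of it to be cubed. *)
Lemma noncentral_square_structureII h :
    #|G| < 2 * #|T| -> h \in T -> h ^+ 2 \notin 'Z(G) -> structureII G.
Proof.
move=> ltT Th nZ; have Gh := cubed_in Th.
have TG : T :&: G = T by apply/setIidPl/cubed_subset.
set D := 'C_G[h ^+ 2]%G; have sDG : D \subset G := subsetIl _ _.
have ltD : #|D| < #|G|.
  rewrite proper_card // properE sDG; apply: contra nZ => sGD.
  apply/centerP; split=> [|g Gg]; first exact: groupX.
  by apply/cent1P; rewrite cent1C; have /setIP[] := subsetP sGD _ Gg.
have := card_cubed_split (subxx G) Th Gh; rewrite TG -/D => leT.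
have leTD : #|T :&: D| <= #|D| by rewrite subset_leq_card ?subsetIr.
have iGD : #|G : D| = 2.
  have := Lagrange sDG; have := cardG_gt0 D; set i := #|G : D| => D0 E.
  have i1 : 1 < i by rewrite -(ltn_pmul2l D0) E muln1.
  have i3 : i < 3 by rewrite -(ltn_pmul2l D0) E; card_lia.
  by card_lia.
have GE : #|G| = (#|D| * 2)%N by rewrite -iGD Lagrange.
have abD : abelian D by apply: three_quarters_abelian => //; card_lia.
have nabG : ~~ abelian G.
  by apply: contra nZ => /center_idP->; rewrite groupX.
apply: (structureII_index2 nabG sDG iGD abD).
by apply: cubed_group_coprime; apply: center_cubed; rewrite ?TG.
Qed.

End CubedFraction.

(** * Cosets of a maximal abelian group of cubed elements *)

Section IndexArithmetic.
Local Open Scope nat_scope.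

(** Here m = |K : H| and e = |H : I|, while y and c are the indices of I in two
    subgroups of an abelian group K which meet H, and each other, in I. *)
Lemma index_arithmetic m e y c m1 m2 :
    m1 * y = m -> m2 * c = m -> y * c <= m * e -> (m - 1) * e < y + c ->
  1 < e -> m <= 2.
Proof.
move=> Ey Ec le_yc lt_yc e1; rewrite leqNgt; apply/negP=> m3.
have le3e : 2 * e <= (m - 1) * e by rewrite leq_mul2r; lia.
have le2m : (m - 1) * 2 <= (m - 1) * e by rewrite leq_mul2l; lia.
have m1_0 : 0 < m1 by lia.
have m2_0 : 0 < m2 by lia.
have [m1_1 | m1_2] := leqP m1 1; have [m2_1 | m2_2] := leqP m2 1; last 1 first.
- have y2 : 2 * y <= m1 * y by rewrite leq_mul2r m1_2 orbT.
  have c2 : 2 * c <= m2 * c by rewrite leq_mul2r m2_2 orbT.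
  lia.
- have E1 : m1 = 1%N by lia.
  have E2 : m2 = 1%N by lia.
  rewrite E1 mul1n in Ey; rewrite E2 mul1n in Ec.
  have : m * m <= m * e by rewrite -{1}Ey -{1}Ec.
  rewrite leq_mul2l; lia.
- have c2 : 2 * c <= m2 * c by rewrite leq_mul2r m2_2 orbT.
  have E1 : m1 = 1%N by lia.
  rewrite E1 mul1n in Ey; have m_3 : m = 3 by lia.
  lia.
have y2 : 2 * y <= m1 * y by rewrite leq_mul2r m1_2 orbT.
have E2 : m2 = 1%N by lia.
rewrite E2 mul1n in Ec; have m_3 : m = 3 by lia.
lia.
Qed.

(** Here 2 k = |B| and N = |G - B|, while T has h + k elements in B, t elements
    outside B, and density at most (k - h) / 2 k outside B. *)
Lemma density_arithmetic k h t N :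
    2 * k <= N -> h <= k -> 0 < h -> 0 < k -> 2 * k * t <= (k - h) * N ->
  2 * (h + k + t) <= 2 * k + N.
Proof.
move=> le_kN le_hk h0 k0 le_t; rewrite leqNgt; apply/negP=> lt_t.
have : 2 * (k * N) < 2 * (k * (2 * h + 2 * t)) by rewrite !ltn_pmul2l //; lia.
have : (k - h) * N + h * N = k * N by rewrite -mulnDl subnK.
have : h * (2 * k) <= h * N by rewrite leq_mul2l le_kN orbT.
lia.
Qed.

End IndexArithmetic.

Section CentralSquares.

Variables (gT : finGroupType) (G : {group gT}) (alpha : {perm gT}).
Hypothesis autG : alpha \in Aut G.
Implicit Types (x y h g a b : gT) (A B H K : {group gT}).

Local Notation T := (cubed_set G alpha).

Hypothesis ltT : #|G| < 2 * #|T|.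
Hypothesis sqZ : {in T, forall h, h ^+ 2 \in 'Z(G)}.

Lemma cubed_mulE x y : x \in T -> y \in T -> (x * y \in T) = (x \in 'C[y]).
Proof.
move=> Tx Ty; apply/idP/cent1P=> [Txy | /(cubed_mul_comm autG Tx Ty) //].
apply: (cubed_mul_commute autG) => //.
exact: central_comm (sqZ Txy) (cubed_in Tx).
Qed.

Lemma center_sub_cubed : 'Z(G) \subset T.
Proof.
by apply: (center_cubed autG (subxx G)); rewrite (setIidPl (cubed_subset G alpha)).
Qed.

(** On K, alpha is k |-> k q(k) with q central, while conjugation by x is
    k |-> q(k) k^-1; comparing the two homomorphisms gives commutation. *)
Lemma abelian_of_cubed_coset K x :
  K \subset G -> x \in T -> {in K, forall k, x * k \in T} -> abelian K.
Proof.
move=> sKG Tx TxK; have Gx := cubed_in Tx.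
pose q k := x ^- 2 * (x * k) ^+ 2.
have Zq k : k \in K -> q k \in 'Z(G).
  by move=> Kk; rewrite groupM ?groupV ?sqZ // TxK.
have qC k g : k \in K -> g \in G -> q k * g = g * q k.
  by move=> Kk Gg; apply: (@central_comm _ G) => //; apply: Zq.
have x2C g : g \in G -> x ^+ 2 * g = g * x ^+ 2.
  by move=> Gg; apply: (@central_comm _ G) => //; apply: sqZ.
have aq k : k \in K -> alpha k = k * q k.
  move=> Kk; have Gk := subsetP sKG _ Kk; rewrite -qC //.
  apply: (mulgI (x ^+ 3)); rewrite -(cubed_aut Tx) -(aut_mul autG) //.
  rewrite (cubed_aut (TxK k Kk)) (cubed_aut Tx) /q.
  have -> : x ^+ 3 * (x ^- 2 * (x * k) ^+ 2 * k) = x * (x * k) ^+ 2 * k by reduce_words.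
  by rewrite -(central_comm (sqZ (TxK k Kk)) Gx); reduce_words.
have xq k : k \in K -> k ^ x = q k * k^-1.
  by move=> _; rewrite /q; reduce_words.
clearbody q.
apply/centsP=> k Kk l Kl; have Kkl : k * l \in K by apply: groupM.
have Gk := subsetP sKG _ Kk; have Gl := subsetP sKG _ Kl.
have qM : q (k * l) = q k * q l.
  apply: (mulgI (k * l)); rewrite -aq // (aut_mul autG) // !aq //.
  by rewrite -!mulgA; congr (k * _); rewrite [LHS]mulgA (qC k l) // mulgA.
have := conjMg k l x; rewrite !xq // qM invMg.
have -> : q k * k^-1 * (q l * l^-1) = q k * q l * (k^-1 * l^-1).
  by rewrite !mulgA; congr (_ * _); rewrite -!mulgA -qC ?groupV.
by move/mulgI/(congr1 (fun g => g^-1)); rewrite !invMg !invgK.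
Qed.

Section MaximalAbelian.

Variable A : {group gT}.
Hypothesis abA : abelian A.
Hypothesis sAT : A \subset T.
Hypothesis maxA : forall A', abelian A' -> A' \subset T -> #|A'| <= #|A|.

Lemma sAG : A \subset G.
Proof. exact: subset_trans sAT (cubed_subset G alpha). Qed.

Lemma join_cubed (C : {group gT}) x :
    abelian C -> C \subset T -> x \in T -> C \subset 'C[x] ->
  abelian (C <*> <[x]>) /\ C <*> <[x]> \subset T.
Proof.
move=> abC sCT Tx cCx.
have cxC : <[x]> \subset 'C(C) by rewrite cycle_subG -sub_cent1.
split; first by rewrite abelianY abC cycle_abelian.
rewrite joingC norm_joinEl ?cents_norm //. 
apply/subsetP=> _ /mulsgP[_ c /cycleP[n ->] Cc ->].
apply: (cubed_mul_comm autG); [exact: cubed_exp | exact: (subsetP sCT) |].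
by apply/commute_sym/commuteX/cent1P/(subsetP cCx).
Qed.

Lemma maximal_contains (A' : {group gT}) x :
    abelian A' -> A' \subset T -> #|A'| = #|A| -> x \in T -> A' \subset 'C[x] -> x \in A'.
Proof.
move=> abA' sA'T oA' Tx cA'x; have [abJ sJT] := join_cubed abA' sA'T Tx cA'x.
have : A' <*> <[x]> \subset A'.
  have /eqP <- // : A' :==: A' <*> <[x]>.
  by rewrite eqEcard joing_subl oA' maxA.
by rewrite join_subG cycle_subG => /andP[].
Qed.

Lemma center_sub_maximal : 'Z(G) \subset A.
Proof.
apply/subsetP=> z Zz; apply: (maximal_contains abA) => //.
  exact: (subsetP center_sub_cubed).
by rewrite sub_cent1; apply: subsetP Zz; rewrite subIset // (centS sAG) orbT.
Qed.

Lemma cubed_coset x : x \in T -> T :&: A :* x = 'C_A[x] :* x.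
Proof.
move=> Tx; apply/setP=> y; rewrite in_setI !mem_rcoset in_setI andbC.
case Ay: (y * x^-1 \in A) => //; rewrite !andTb -{1}(mulgKV x y).
by rewrite cubed_mulE // (subsetP sAT).
Qed.

Lemma card_cubed_coset x : x \in T -> #|T :&: A :* x| = #|'C_A[x]|.
Proof. by move=> Tx; rewrite cubed_coset // card_rcoset. Qed.

Lemma card_cent_proper x : x \in T -> x \notin A -> 2 * #|'C_A[x]| <= #|A|.
Proof.
move=> Tx nAx; rewrite -(Lagrange (subsetIl A 'C[x])) mulnC leq_mul2l.
rewrite indexg_gt1; apply/orP; right; apply: contra nAx => sAC.
by apply: maximal_contains => //; apply: subset_trans sAC (subsetIr _ _).
Qed.

Lemma card_cubed_coset_le g : g \notin A -> 2 * #|T :&: A :* g| <= #|A|.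
Proof.
move=> nAg; case: (set_0Vmem (T :&: A :* g)) => [-> | [x /setIP[Tx Agx]]].
  by rewrite cards0 muln0.
rewrite -(rcoset_eqP Agx) card_cubed_coset // card_cent_proper //.
by apply: contra nAg => Ax; move: Agx; rewrite mem_rcoset groupMl // groupV.
Qed.

Lemma card_cubed_stable (U : {set gT}) :
    {in A & U, forall a g, a * g \in U} -> {in U, forall g, g \notin A} ->
  2 * #|T :&: U| <= #|U|.
Proof.
move=> AU nUA; have := @average_cosets _ A U T 2 #|A| AU.
move/(_ (fun g Ug => card_cubed_coset_le (nUA g Ug))).
by rewrite mulnCA leq_pmul2l // cardG_gt0.
Qed.

(** In 2 |T| - |G| the subgroup A contributes |A|, and no union of other cosets
    contributes a positive amount; so V cannot contribute - |A| or less. *)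
Lemma cubed_excess (V : {set gT}) :
    V \subset G :\: A -> {in A & V, forall a g, a * g \in V} ->
  #|V| < #|A| + 2 * #|T :&: V|.
Proof.
move=> sVGA AV; pose U := G :\: A :\: V.
have UE g : (g \in U) = [&& g \notin V, g \notin A & g \in G] by rewrite !in_setD.
have VA g : g \in V -> g \notin A by move/(subsetP sVGA)/setDP=> [].
have AU : {in A & U, forall a g, a * g \in U}.
  move=> a g Aa; rewrite !UE => /and3P[nVg nAg Gg]; apply/and3P; split.
  - by apply: contra nVg => Vag; rewrite -(mulKg a g) AV ?groupV.
  - by rewrite groupMl.
  by rewrite groupMl // (subsetP sAG).
have nUA : {in U, forall g, g \notin A} by move=> g; rewrite UE => /and3P[].
have := card_cubed_stable AU nUA.
have := cardsID A G; have := cardsID A T.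
have := cardsID V (G :\: A); have := cardsID V (T :\: A).
rewrite (setIidPr sVGA) (setIidPr sAG) (setIidPr sAT).
have -> : (T :\: A) :&: V = T :&: V.
  apply/setP=> g; rewrite !in_setI in_setD.
  by case Vg: (g \in V); rewrite ?andbF // (VA g Vg).
have -> : T :\: A :\: V = T :&: U.
  apply/setP=> g; rewrite in_setI UE !in_setD.
  by case Tg: (g \in T); rewrite ?andbF // (cubed_in Tg) !andbT.
move: ltT; card_lia.
Qed.

Lemma coset_sub_compl x : x \in G -> x \notin A -> A :* x \subset G :\: A.
Proof.
move=> Gx nAx; apply/subsetP=> _ /rcosetP[a Aa ->].
by rewrite in_setD groupMl // nAx groupM // (subsetP sAG).
Qed.

Lemma coset_stable x : {in A & A :* x, forall a g, a * g \in A :* x}.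
Proof. by move=> a g Aa; rewrite !mem_rcoset => Agx; rewrite -mulgA groupM. Qed.

Lemma coset_meets_cubed x : x \in G -> exists2 a, a \in A & a * x \in T.
Proof.
move=> Gx; have [Ax | nAx] := boolP (x \in A).
  by exists x^-1; [rewrite groupV | rewrite mulVg (cubed_one autG)].
have := cubed_excess (coset_sub_compl Gx nAx) (@coset_stable x).
rewrite card_rcoset -[X in X < _]addn0 ltn_add2l muln_gt0 => /card_gt0P[y].
case/setIP=> Ty; rewrite mem_rcoset => Ay.
by exists (y * x^-1); rewrite ?mulgKV.
Qed.

Lemma two_cosets x y :
    x \in G -> y \in G -> x \notin A -> y \notin A -> y \notin A :* x ->
  #|A| < 2 * #|T :&: A :* x| + 2 * #|T :&: A :* y|.
Proof.
move=> Gx Gy nAx nAy nAxy.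
have dis : [disjoint A :* x & A :* y].
  apply/pred0P=> z /=; apply/andP=> -[] /[!mem_rcoset] Axz Ayz.
  case/negP: nAxy; rewrite mem_rcoset.
  have -> : y * x^-1 = (z * y^-1)^-1 * (z * x^-1) by reduce_words.
  by rewrite groupM ?groupV.
have sV : A :* x :|: A :* y \subset G :\: A by rewrite subUset !coset_sub_compl.
have AV : {in A & A :* x :|: A :* y, forall a g, a * g \in A :* x :|: A :* y}.
  move=> a g Aa; rewrite in_setU => /orP[]/(coset_stable Aa) Vag;
  by rewrite in_setU Vag ?orbT.
have := cubed_excess sV AV.
rewrite setIUr; have := cardsUI (A :* x) (A :* y); rewrite (disjoint_setI0 dis).
have := cardsUI (T :&: A :* x) (T :&: A :* y).
rewrite !cards0 !card_rcoset; card_lia.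
Qed.

(** * The centralizer of a hyperplane *)

Section Hyperplane.

Variable H : {group gT}.
Hypotheses (sHA : H \subset A) (iAH : #|A : H| = 2) (sZH : 'Z(G) \subset H).

Local Notation B := 'C_G(H)%G.

Let T0 := T :&: B :\: H.

Lemma maximal_sub_cent : A \subset B.
Proof. by rewrite subsetI sAG (subset_trans abA) // centS. Qed.

Lemma card_maximal : #|A| = (2 * #|H|)%N.
Proof. by rewrite -(Lagrange sHA) iAH mulnC. Qed.

Lemma T0P x : reflect [/\ x \in T, x \in B & x \notin H] (x \in T0).
Proof. by rewrite in_setD in_setI; apply: (iffP and3P) => -[]. Qed.

Lemma cent_hyperplane x : x \in B -> H \subset 'C[x].
Proof. by case/setIP=> _ cHx; rewrite sub_cent1. Qed.

(** The group H <x> already has the maximal order |A|, so it contains y, and H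
    has index 2 in it. *)
Lemma T0_commute x y : x \in T0 -> y \in T0 -> commute x y -> x^-1 * y \in H.
Proof.
case/T0P=> Tx Bx nHx /T0P[Ty By nHy] cxy.
have abH := abelianS sHA abA; have sHT := subset_trans sHA sAT.
have [abJ sJT] := join_cubed abH sHT Tx (cent_hyperplane Bx).
have sHJ : H \subset H <*> <[x]> := joing_subl _ _.
have Jx : x \in H <*> <[x]> by rewrite mem_gen // inE cycle_id orbT.
have iJ : #|H <*> <[x]> : H| = 2.
  have := maxA abJ sJT; rewrite card_maximal -(Lagrange sHJ) mulnC leq_pmul2r // => le2.
  apply/eqP; rewrite eqn_leq le2 ltnNge; apply: contra nHx => le1.
  have := index1g sHJ; rewrite (_ : #|_ : _| = 1%N); last first.
    by apply/eqP; rewrite eqn_leq le1 indexg_gt0.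
  by move/(_ erefl) => ->.
have Jy : y \in H <*> <[x]>.
  apply: maximal_contains => //; first by rewrite card_maximal -(Lagrange sHJ) iJ mulnC.
  rewrite join_subG cent_hyperplane // cycle_subG; exact/cent1P.
by rewrite (index2_mul sHJ iJ) ?groupV // (negPf nHx) (negPf nHy).
Qed.

Lemma T0_mul x y : x \in T0 -> y \in T0 -> x * y \notin T0.
Proof.
move=> T0x T0y; have [Tx Bx nHx] := T0P x T0x; have [Ty By nHy] := T0P y T0y.
apply/negP=> /T0P[Txy _] /negP[].
have -> : x * y = x ^+ 2 * (x^-1 * y) by reduce_words.
apply: groupM; first by rewrite (subsetP sZH) ?sqZ.
by apply: T0_commute => //; apply/cent1P; rewrite -cubed_mulE.
Qed.

Lemma T0_inv x : x \in T0 -> x^-1 \in T0.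
Proof. by case/T0P=> Tx Bx nHx; apply/T0P; rewrite cubed_inv // groupV groupV. Qed.

(** Each coset of A in B other than A meets T, in exactly |H| elements since C_A
    of such an element contains H and is proper. *)
Lemma card_T0 : #|B| = (2 * #|T0|)%N.
Proof.
have sAB := maximal_sub_cent.
have AU : {in A & B :\: A, forall a g, a * g \in B :\: A}.
  move=> a g Aa /setDP[Bg nAg]; rewrite in_setD groupMl // nAg groupM //.
  exact: subsetP Aa.
have cardAy y : y \in B :\: A -> #|T :&: A :* y| = #|H|.
  case/setDP=> By nAy; have Gy : y \in G by case/setIP: By.
  have [a Aa Tay] := coset_meets_cubed Gy.
  have Bay : a * y \in B by rewrite groupM // (subsetP sAB).
  have nAay : a * y \notin A by rewrite groupMl.
  have <- : A :* (a * y) = A :* y by rewrite rcosetM (rcoset_id Aa).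
  rewrite card_cubed_coset //; apply/eqP; rewrite eqn_leq.
  have := card_cent_proper Tay nAay; rewrite card_maximal leq_pmul2l // => ->.
  by rewrite subset_leq_card // subsetI sHA cent_hyperplane.
have := sum_card_cosets T AU; rewrite (eq_bigr (fun=> #|H|)) => [|g Ug]; last exact: cardAy.
rewrite sum_nat_const card_maximal => E.
have {}E : #|B :\: A| = (2 * #|T :&: (B :\: A)|)%N.
  by apply/eqP; rewrite -(eqn_pmul2r (cardG_gt0 H)) E mulnAC.
have := cardsID A B; have := cardsID A (T :&: B); have := cardsID H (T :&: B).
have -> : T :&: B :&: A = A by apply/setIidPr; rewrite subsetI sAT.
have -> : T :&: B :&: H = H.
  by apply/setIidPr; rewrite subsetI !(subset_trans sHA).
have -> : T :&: B :\: A = T :&: (B :\: A) by rewrite setIDA.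
rewrite (setIidPr sAB) -/T0; have := card_maximal; card_lia.
Qed.

(** The elements of T0 behave like reflections: a product of two of them is not
    in T0.  Counting then gives B - T0 = T0 x = x^-1 T0 for every x in T0, and so
    B - T0 is closed under products. *)
Lemma hyperplane_complement :
  exists K : {group gT}, [/\ abelian K, K \subset B, #|B| = (2 * #|K|)%N,
                             B :\: K \subset T & T :&: K = H].
Proof.
have sAB := maximal_sub_cent; have sT0B : T0 \subset B := subset_trans (subsetDl _ _) (subsetIr _ _).
have cT0 := card_T0.
have [x T0x] : exists x, x \in T0.
  by apply/card_gt0P; have := cardG_gt0 B; rewrite cT0; case: #|T0|.
have cK : #|B :\: T0| = #|T0|.
  by have := cardsID T0 B; rewrite (setIidPr sT0B) cT0 mul2n -addnn => /addnI.
have KE y : y \in T0 -> B :\: T0 = T0 :* y /\ B :\: T0 = y^-1 *: T0.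
  move=> T0y.
  have By := subsetP sT0B _ T0y.
  split; apply/esym/eqP; rewrite eqEcard ?card_rcoset ?card_lcoset cK leqnn andbT.
    apply/subsetP=> _ /rcosetP[t T0t ->]; rewrite in_setD T0_mul // groupM //.
    exact: subsetP T0t.
  apply/subsetP=> _ /lcosetP[t T0t ->]; rewrite in_setD T0_mul ?T0_inv //.
  by rewrite groupM ?groupV // (subsetP sT0B).
have gK : group_set (B :\: T0).
  apply/group_setP; split; first by rewrite !in_setD !group1 andbT.
  move=> k l; have [E1 E2] := KE x T0x.
  rewrite {1}E1 {1}E2 => /rcosetP[t T0t ->] /lcosetP[u T0u ->].
  rewrite -mulgA mulKVg in_setD T0_mul // groupM ?(subsetP sT0B) //.
pose K := Group gK; exists K.
have [Tx Bx _] := T0P x T0x.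
have sKB : K \subset B by apply: subsetDl.
have HK : T :&: K = H.
  apply/setP=> k; rewrite in_setI !in_setD in_setI.
  case Hk: (k \in H); rewrite /=.
    by rewrite (subsetP sAB) ?(subsetP sHA) // (subsetP sAT) ?(subsetP sHA).
  by case: (k \in T); case: (k \in B).
split=> //.
- apply: (@abelian_of_cubed_coset K x) => //; first exact: subset_trans sKB (subsetIl _ _).
  move=> k Kk; have : k \in x^-1 *: T0 by rewrite -(KE x T0x).2.
  by case/lcosetP=> t /T0P[Tt _ _] ->; rewrite mulKVg.
- by rewrite -cK in cT0.
apply/subsetP=> t; rewrite !in_setD negb_and negbK => /andP[].
by case Bt: (t \in B); rewrite ?orbF // => /andP[_ /setIP[]].
Qed.

(** If K is the complement above and w is a cubed element outside B, the
    elements b of K with b w cubed form a subgroup: for them alpha b is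
    b (w b w^-1) b, which is multiplicative on the abelian group K. *)
Lemma cubed_translates_group (K : {group gT}) w :
    abelian K -> K \subset G -> 'Z(G) \subset K -> w \in T ->
  group_set [set b in K | b * w \in T].
Proof.
move=> abK sKG sZK Tw; have Gw := cubed_in Tw.
have kJ b : b \in K -> b * w \in T ->
    w * b * w^-1 \in K /\ alpha b = b * (w * b * w^-1) * b.
  move=> Kb Tbw; have Gb := subsetP sKG _ Kb; split.
    have -> : w * b * w^-1 = b^-1 * ((b * w) ^+ 2 * w ^- 2) by reduce_words.
    rewrite groupM ?groupV // groupM // ?groupV; apply: (subsetP sZK); exact: sqZ.
  apply: (mulIg (w ^+ 3)); rewrite -{1}(cubed_aut Tw) -(aut_mul autG) // (cubed_aut Tbw).
  have -> : b * (w * b * w^-1) * b * w ^+ 3 = b * (w * b * w^-1) * (b * w ^+ 2) * w.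
    by reduce_words.
  by rewrite -(central_comm (sqZ Tw) Gb); reduce_words.
apply/group_setP; split; first by rewrite in_set group1 mul1g.
move=> b c /setIdP[Kb Tb] /setIdP[Kc Tc]; apply/setIdP; split; first exact: groupM.
have [KbJ ab] := kJ b Kb Tb; have [KcJ ac] := kJ c Kc Tc.
have Gb := subsetP sKG _ Kb; have Gc := subsetP sKG _ Kc.
have cK k l : k \in K -> l \in K -> k * l = l * k.
  by move=> Kk Kl; apply: (centsP abK).
apply/cubedP; split; first by rewrite !groupM.
rewrite !(aut_mul autG) ?groupM // ab ac (cubed_aut Tw).
have [bw bwE] : {g | w * b * w^-1 = g} by exists (w * b * w^-1).
have [cw cwE] : {g | w * c * w^-1 = g} by exists (w * c * w^-1).
rewrite bwE cwE in KbJ KcJ *.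
have -> : (b * c * w) ^+ 3 = (b * c) * (bw * cw) * (w ^+ 2 * (b * c)) * w.
  by rewrite -bwE -cwE; reduce_words.
rewrite (central_comm (sqZ Tw) (groupM Gb Gc)).
have -> : b * bw * b * (c * cw * c) = (b * c) * (bw * cw) * (b * c).
  rewrite -!mulgA; congr (b * _).
  rewrite mulgA [in LHS]mulgA (cK (bw * b) c) ?groupM // -!mulgA; congr (c * (bw * _)).
  by rewrite mulgA [RHS]mulgA (cK b cw).
by reduce_words.
Qed.

(** If |K : H| > 2, some coset B w with w cubed contains more than |K| - |H|
    cubed elements b w.  Those with b outside K have b cubed and commuting with
    w, so they are at most |C_K(w)| in number.  The others have b in the subgroup
    Y of the preceding lemma.  Now Y, C_K(w) and H meet pairwise in C_H(w), and
    the divisibilities between the indices leave no room. *)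
Lemma hyperplane_cent_small : ~~ (G \subset 'C(H)) -> #|B| <= 2 * #|A|.
Proof.
move=> nGC; have [K [abK sKB cB sBKT TKH]] := hyperplane_complement.
have sHK : H \subset K by rewrite -TKH subsetIr.
have sBG : B \subset G := subsetIl _ _.
have sKG := subset_trans sKB sBG.
have sHT := subset_trans sHA sAT.
have iBK : #|B : K| = 2 by apply/eqP; rewrite -(eqn_pmul2l (cardG_gt0 K)) Lagrange // cB mulnC.
have ltBG : #|B| < #|G|.
  by rewrite proper_card // properE sBG subsetI subxx.
have leHK : #|H| <= #|K| := subset_leq_card sHK.
have N2b : 2 * #|K| <= #|G :\: B|.
  have := cardsID B G; rewrite (setIidPr sBG) -(Lagrange sBG) => E.
  have := ltBG; rewrite -(Lagrange sBG) -{1}[#|B|]muln1 ltn_pmul2l // => i2.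
  rewrite -cB; have := leq_mul (leqnn #|B|) i2; rewrite muln2 -E; card_lia.
have BU : {in B & G :\: B, forall b g, b * g \in G :\: B}.
  move=> b g Bb /setDP[Gg nBg]; rewrite in_setD groupMl // nBg groupM //.
  exact: (subsetP sBG).
have cTB : #|T :&: B| = (#|H| + #|K|)%N.
  have := cardsID K (T :&: B).
  rewrite -setIA (setIidPr sKB) TKH -setIDA (setIidPr sBKT) => <-; congr (_ + _)%N.
  by have := cardsID K B; rewrite (setIidPr sKB) cB mul2n -addnn => /addnI.
have [w [Tw nBw ltX]] : exists w, [/\ w \in T, w \notin B & #|K| < #|H| + #|T :&: B :* w|].
  case: (pickP [pred g in G :\: B | #|K| < #|H| + #|T :&: B :* g|]) => [g | noX].
    case/andP=> /setDP[Gg nBg] ltX.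
    have /card_gt0P[w /setIP[Tw Bgw]] : 0 < #|T :&: B :* g|.
      by move: leHK ltX; card_lia.
    exists w; rewrite (rcoset_eqP Bgw); split=> //.
    apply: contra nBg => Bw; move: Bgw; rewrite mem_rcoset groupMl // groupV.
    by [].
  have le1 : {in G :\: B, forall g, 1 * #|T :&: B :* g| <= #|K| - #|H|}.
    move=> g Ug; have := noX g; rewrite inE Ug andTb mul1n => /negbT.
    by move: leHK; card_lia.
  have := average_cosets BU le1; rewrite mul1n cB.
  have := cardsID B T; rewrite cTB; have -> : T :\: B = T :&: (G :\: B).
    by rewrite setIDA (setIidPl (cubed_subset G alpha)).
  have := cardsID B G; rewrite (setIidPr sBG) cB.
  move=> EG ET leN; have := ltT; rewrite -EG -ET ltnNge.
  by rewrite density_arithmetic.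
have Gw := cubed_in Tw.
pose Y := Group (cubed_translates_group abK sKG (subset_trans sZH sHK) Tw).
pose C := 'C_K[w]%G; pose I := 'C_H[w]%G.
have YP b : reflect (b \in K /\ b * w \in T) (b \in Y) by apply: setIdP.
have sYK : Y \subset K by apply/subsetP=> b /YP[].
have sCK : C \subset K := subsetIl _ _.
have sIH : I \subset H := subsetIl _ _.
have YH : Y :&: H = I.
  apply/setP=> b; rewrite !in_setI andbC; case Hb: (b \in H) => //.
  rewrite !andTb; apply/YP/idP=> [[_] | cb]; first by rewrite cubed_mulE // (subsetP sHT).
  by split; [exact: (subsetP sHK) | rewrite cubed_mulE // (subsetP sHT)].
have CH : C :&: H = I by rewrite setIAC (setIidPr sHK).
have YC : Y :&: C = I.
  apply/setP=> b; rewrite in_setI [in LHS]in_setI [in RHS]in_setI.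
  case cb: (b \in 'C[w]); rewrite ?andbF // !andbT.
  apply/andP/idP=> [[/YP[Kb Tb] _] | Hb].
    rewrite -TKH in_setI Kb andbT -(mulgK w b).
    apply: (cubed_mul_comm autG); rewrite ?cubed_inv //.
    apply: commuteV; apply: commute_sym.
    by apply: commuteM; [apply/commute_sym/cent1P | exact: commute_refl].
  split; last exact: (subsetP sHK).
  apply/YP; split; first exact: (subsetP sHK).
  by rewrite cubed_mulE // (subsetP sHT).
have leX : #|T :&: B :* w| <= #|Y| + #|C|.
  have -> : #|T :&: B :* w| = #|[set b in B | b * w \in T]|.
    rewrite -[RHS](card_rcoset _ w); apply: eq_card => g.
    rewrite [RHS]mem_rcoset [RHS]in_set mulgKV.
    by rewrite [LHS]in_setI mem_rcoset andbC.
  rewrite -(cardsID K); apply: leq_add.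
    apply/subset_leq_card/subsetP=> b; rewrite in_setI in_set => /andP[/andP[_ Tb] Kb].
    exact/YP.
  set X := _ :\: _; case: (set_0Vmem X) => [-> | [t Xt]]; first by rewrite cards0.
  have XP u : u \in X -> [/\ u \in B, u \notin K & commute u w].
    rewrite in_setD in_set => /and3P[nKu Bu Tuw]; split=> //.
    by apply/cent1P; rewrite -cubed_mulE // (subsetP sBKT) // in_setD nKu.
  have [Bt nKt ct] := XP t Xt.
  rewrite -(card_lcoset X t^-1); apply/subset_leq_card/subsetP=> _ /lcosetP[u Xu ->].
  have [Bu nKu cu] := XP u Xu.
  rewrite in_setI (index2_mul sKB iBK) ?groupV // (negPf nKt) (negPf nKu) /=.
  apply: groupM; first rewrite groupV; exact/cent1P.
have abYH : commute Y H by apply/centC/(subset_trans (subset_trans sYK abK))/centS.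
have abCH : commute C H by apply/centC/(subset_trans (subset_trans sCK abK))/centS.
have [m Em] : exists m, #|K| = (m * #|H|)%N by exists #|K : H|; rewrite mulnC Lagrange.
have [e Ee] : exists e, #|H| = (e * #|I|)%N by exists #|H : I|; rewrite mulnC Lagrange.
have [p Ey] : exists p, #|Y| = (p * #|I|)%N.
  by exists #|Y : I|; rewrite mulnC Lagrange // -YH subsetIl.
have [r Ec] : exists r, #|C| = (r * #|I|)%N.
  by exists #|C : I|; rewrite mulnC Lagrange // -CH subsetIl.
have I0 := cardG_gt0 I; have H0 := cardG_gt0 H.
have factor (L : {group gT}) l : L \subset K -> commute L H -> L :&: H = I ->
    #|L| = (l * #|I|)%N -> exists k, (k * l = m)%N.
  move=> sLK cLH LH El; have sLHK : (L * H)%g \subset K by rewrite mul_subG.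
  have := mul_cardG L H; rewrite LH; have gLH := comm_joingE cLH.
  have := Lagrange (_ : L <*> H \subset K); rewrite gLH => /(_ sLHK).
  rewrite /= gLH; set k := #|_ : _| => Ek E; exists k.
  have EL : #|(L * H)%g| = (l * #|H|)%N.
    by apply/eqP; rewrite -(eqn_pmul2r I0) -E El mulnAC.
  by apply/eqP; rewrite -(eqn_pmul2r H0) -Em -Ek EL -mulnA mulnC.
have [m1 Em1] := factor _ _ sYK abYH YH Ey.
have [m2 Em2] := factor _ _ sCK abCH CH Ec.
have le_yc : (p * r <= m * e)%N.
  have := mul_cardG Y C; rewrite YC => E.
  have : #|(Y * C)%g| <= #|K| by rewrite subset_leq_card // mul_subG.
  rewrite -(leq_pmul2r I0) -E Em Ee Ey Ec.
  by rewrite mulnACA [X in _ <= X](_ : _ = m * e * (#|I| * #|I|))%N ?leq_pmul2r ?muln_gt0 ?I0 // !mulnA.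
have e1 : (1 < e)%N.
  rewrite ltnNge; apply: contra nBw => le1.
  have IH : I :=: H.
    by apply/eqP; rewrite eqEcard sIH Ee -[X in _ <= X]mul1n leq_mul2r le1 orbT.
  by rewrite in_setI Gw -sub_cent1 -IH subsetIr.
have m2' := index_arithmetic Em1 Em2 le_yc _ e1.
rewrite cB Em card_maximal leq_pmul2l // leq_pmul2r // m2' //.
rewrite -(ltn_pmul2r I0) mulnDl -Ey -Ec -mulnA -Ee mulnBl mul1n -Em.
by move: ltX leX leHK; card_lia.
Qed.

End Hyperplane.

(** * Class two *)

Section NoAbelianIndexTwo.

Hypothesis nabG : ~~ abelian G.
Hypothesis noII : forall K, K \subset G -> #|G : K| = 2 -> ~~ abelian K.

(** The coset A x of a good x is half filled by T. *)
Definition good x := [&& x \in T, x \notin A & #|A : 'C_A[x]| == 2].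

Lemma goodP x : reflect [/\ x \in T, x \notin A & #|A : 'C_A[x]| = 2] (good x).
Proof. by apply: (iffP and3P) => -[? ? /eqP]. Qed.

Lemma two_maximal_lt : 2 * #|A| < #|G|.
Proof.
rewrite -(Lagrange sAG) mulnC ltn_pmul2l // ltn_neqAle indexg_gt1 eq_sym.
apply/andP; split; first by apply/eqP=> /(noII sAG); rewrite abA.
by apply: contra nabG => sGA; apply: abelianS abA.
Qed.

Lemma center_sub_cent_maximal x : x \in T -> 'Z(G) \subset 'C_A[x].
Proof.
move=> Tx; rewrite subsetI center_sub_maximal /=; apply/subsetP=> z Zz.
by apply/cent1P; apply: central_comm Zz (cubed_in Tx).
Qed.

(** The centralizer of C_A(x) contains A and A x, and its order is at most 2 |A|. *)
Lemma good_cent x y :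
    good x -> y \in G -> 'C_A[x] \subset 'C[y] -> y \in A \/ y \in A :* x.
Proof.
case/goodP=> Tx nAx iAx Gy cHy; pose H := 'C_A[x]%G.
have sHA : H \subset A := subsetIl _ _.
have sZH : 'Z(G) \subset H := center_sub_cent_maximal Tx.
have nGC : ~~ (G \subset 'C(H)).
  apply/negP=> sGC; have [K [abK sKB cB _ _]] := hyperplane_complement sHA iAx sZH.
  have BG : 'C_G(H) = G by apply/setIidPl.
  rewrite /= BG in sKB cB; have iK : #|G : K| = 2; last by move: (noII sKB iK); rewrite abK.
  by apply/eqP; rewrite -(eqn_pmul2l (cardG_gt0 K)) Lagrange // cB mulnC.
have leB := hyperplane_cent_small sHA iAx sZH nGC.
have sAB := maximal_sub_cent sHA.
have inB w : w \in G -> H \subset 'C[w] -> w \in 'C_G(H).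
  by move=> Gw cHw; rewrite in_setI Gw -sub_cent1.
have Bx : x \in 'C_G(H) by rewrite inB ?(cubed_in Tx) // subsetIr.
have By := inB y Gy cHy.
have sub : A :|: A :* x \subset 'C_G(H).
  rewrite subUset sAB; apply/subsetP=> _ /rcosetP[a Aa ->].
  by rewrite groupM // (subsetP sAB).
have : A :|: A :* x = 'C_G(H).
  apply/eqP; rewrite eqEcard sub; apply: leq_trans leB _.
  have := cardsUI A (A :* x); rewrite card_rcoset.
  have -> : A :&: A :* x = set0.
    apply/setP=> g; rewrite in_setI in_set0 mem_rcoset; apply/andP=> -[Ag].
    by rewrite groupMl // groupV (negPf nAx).
  by rewrite cards0; card_lia.
by move/setP/(_ y); rewrite By in_setU => /orP.
Qed.

(** The index of C_A(x) is at least 2, and it is not 3 as |A| is prime to 3. *)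
Lemma not_good_card x : x \in T -> x \notin A -> ~~ good x -> 4 * #|'C_A[x]| <= #|A|.
Proof.
move=> Tx nAx; rewrite /good Tx nAx /= => i2.
have sCA : 'C_A[x] \subset A := subsetIl _ _.
have := card_cent_proper Tx nAx; rewrite -(Lagrange sCA) !(mulnC _ #|'C_A[x]|).
rewrite !leq_pmul2l // => i1.
have : #|A : 'C_A[x]| != 3.
  apply/eqP=> i3; have := cubed_group_coprime autG sAT; rewrite -(Lagrange sCA) i3.
  by rewrite coprimeMl andbC.
by move: i1 i2; case: #|A : _| => [|[|[|[|]]]].
Qed.

Lemma not_good_unique x y :
    x \in T -> y \in T -> x \notin A -> y \notin A -> ~~ good x -> ~~ good y ->
  y \in A :* x.
Proof.
move=> Tx Ty nAx nAy ngx ngy; apply: contraT => nAxy.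
have := two_cosets (cubed_in Tx) (cubed_in Ty) nAx nAy nAxy.
rewrite !card_cubed_coset //.
by have := not_good_card Tx nAx ngx; have := not_good_card Ty nAy ngy; card_lia.
Qed.

(** The cosets of A outside M would all be bad, hence there would be only one
    of them and A would have index 2. *)
Lemma good_generate (M : {group gT}) :
    M \subset G -> A \subset M -> (forall x, good x -> x \in M) -> M :=: G.
Proof.
move=> sMG sAM goodM; apply/eqP; rewrite eqEsubset sMG; apply: contraT => nsGM.
have [g Gg nMg] := subsetPn nsGM.
have bad y : y \in G -> y \notin M ->
    exists2 a, a \in A & [/\ a * y \in T, a * y \notin A & ~~ good (a * y)].
  move=> Gy nMy; have [a Aa Tay] := coset_meets_cubed Gy; exists a => //.
  have nMay : a * y \notin M by rewrite groupMl // (subsetP sAM).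
  split=> //; first by apply: contra nMay; apply: (subsetP sAM).
  by apply: contra nMay; apply: goodM.
have [a Aa [Tag nAag ngag]] := bad g Gg nMg.
have sub : G :\: M \subset A :* (a * g).
  apply/subsetP=> y /setDP[Gy nMy]; have [b Ab [Tby nAby ngby]] := bad y Gy nMy.
  have := not_good_unique Tag Tby nAag nAby ngag ngby.
  by rewrite !mem_rcoset -mulgA groupMl.
have i2 : 2 * #|M| <= #|G|.
  rewrite -(Lagrange sMG) mulnC leq_pmul2l // ltnNge.
  apply: contra nsGM => le1.
  have iM : #|G : M| = 1%N by apply/eqP; rewrite eqn_leq le1 indexg_gt0.
  by rewrite (index1g sMG iM) subxx.
have := subset_leq_card sub; rewrite card_rcoset.
have := cardsID M G; rewrite (setIidPr sMG); have := two_maximal_lt.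
by have := subset_leq_card sAM; card_lia.
Qed.

(** Since a^x centralizes C_A(x), it lies in A or in A x; in the second case
    x^-1 a = a^x x^-1 would be in A. *)
Lemma good_normalize x : good x -> x \in 'N(A).
Proof.
move=> gx; have [Tx nAx iAx] := goodP x gx.
have [Gx cx] : x \in G /\ x \in 'C('C_A[x]) by rewrite -sub_cent1 subsetIr (cubed_in Tx).
apply/normP; apply/eqP; rewrite eqEcard cardJg leqnn andbT.
apply/subsetP=> _ /imsetP[a Aa ->].
have cH : 'C_A[x] \subset 'C[a ^ x].
  apply/subsetP=> h /setIP[Ah /cent1P chx]; apply/cent1P.
  have <- : h ^ x = h by apply/conjg_fixP/commgP.
  by rewrite /commute -!conjMg (centsP abA _ Aa _ Ah).
have [// | Axax] := good_cent gx (groupJ (subsetP sAG _ Aa) Gx) cH.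
case/negP: nAx; move: Axax; rewrite mem_rcoset.
have -> : a ^ x * x^-1 = x^-1 * a by reduce_words.
by rewrite groupMr // groupV.
Qed.

Lemma maximal_normal : A <| G.
Proof.
rewrite /normal sAG; have := good_generate (subsetIl G 'N(A)) _ _.
rewrite subsetI sAG normG => /(_ isT) <-; first exact: subsetIr.
by move=> x gx; have [Tx _ _] := goodP x gx; rewrite in_setI good_normalize // (cubed_in Tx).
Qed.

Lemma sqr_in_maximal g : g \in G -> g ^+ 2 \in A.
Proof.
move=> Gg; have [a Aa Tag] := coset_meets_cubed Gg.
have -> : g ^+ 2 = a^-1 * (a * g) ^+ 2 * (a^-1 ^ g) by reduce_words.
have Ng := subsetP (normal_norm maximal_normal) g Gg.
rewrite groupM ?memJ_norm ?groupV // groupM ?groupV //.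
exact: (subsetP center_sub_maximal _ (sqZ Tag)).
Qed.

(** Modulo A all squares are trivial, and x^g x^-1 is a product of squares. *)
Lemma conj_in_coset x g : x \in G -> g \in G -> x ^ g * x^-1 \in A.
Proof.
move=> Gx Gg.
have -> : x ^ g * x^-1 = g ^- 2 * (g * x) ^+ 2 * x ^- 2 by reduce_words.
have Ggx : g * x \in G by apply: groupM.
by do 2?[apply: groupM]; rewrite ?groupV sqr_in_maximal.
Qed.

(** The commutator of A with a good x takes a single nontrivial value, which
    does not change under conjugation because G / A is abelian. *)
Lemma good_comm x :
    good x ->
  exists2 z, z \in 'Z(G) & z != 1 /\ {in A, forall a, [~ a, x] = if a \in 'C[x] then 1 else z}.
Proof.
move=> gx; have [Tx nAx iAx] := goodP x gx; have Gx := cubed_in Tx.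
have nAG := subsetP (normal_norm maximal_normal).
have Acomm a : a \in A -> [~ a, x] \in A.
  by move=> Aa; rewrite commgEl groupM ?groupV // memJ_norm // nAG.
have [a0 Aa0 nCa0] : exists2 a, a \in A & a \notin 'C[x].
  apply/subsetPn; apply: contra nAx => sAC; exact: maximal_contains sAC.
pose z := [~ a0, x].
have zE a : a \in A -> [~ a, x] = if a \in 'C[x] then 1 else z.
  move=> Aa; case: ifPn => [/cent1P/commgP/eqP // | nCa].
  have : a0^-1 * a \in 'C_A[x].
    by rewrite (index2_mul (subsetIl _ _) iAx) ?groupV // !in_setI Aa0 Aa (negPf nCa) (negPf nCa0).
  case/setIP=> Ah /cent1P/commgP/eqP h1.
  rewrite -(mulKVg a0 a) commMgJ h1 mulg1; apply/conjg_fixP/commgP.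
  exact: (centsP abA _ (Acomm _ Aa0)).
exists z; last split=> //; last first.
  by apply: contra nCa0 => z1; apply/cent1P/commgP.
have nz1 : z != 1 by apply: contra nCa0 => z1; apply/cent1P/commgP.
apply/centerP; split=> [|g Gg]; first by apply: (subsetP sAG); apply: Acomm.
apply/commgP/conjg_fixP.
have Aa0g : a0 ^ g \in A by rewrite memJ_norm // nAG.
have zg : z ^ g = [~ a0 ^ g, x].
  rewrite conjRg; have := conj_in_coset Gx Gg; set b := x ^ g * x^-1 => Ab.
  have cb : [~ a0 ^ g, b] = 1 by apply/eqP/commgP; apply: (centsP abA).
  by rewrite -(mulgKV x (x ^ g)) -/b commgMJ cb conj1g mulg1.
rewrite zg zE //; case: ifP => // Ca0g; case/negP: nz1.
by rewrite -(conjg_eq1 z g) zg zE // Ca0g.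
Qed.

(** To place all commutators [s, g] with s in S in a central subgroup W, it
    is enough to treat the g in A and the good g. *)
Lemma comm_good (S : {set gT}) (W : {group gT}) :
    S \subset G -> W \subset 'Z(G) ->
    {in S & A, forall s a, [~ s, a] \in W} ->
    {in S, forall s x, good x -> [~ s, x] \in W} ->
  {in S & G, forall s g, [~ s, g] \in W}.
Proof.
move=> sSG sWZ SA Sgood s g Ss Gg.
pose M := Group (comm_central_group_set sSG sWZ (groupP W)).
have MG : M :=: G.
  apply: good_generate; first by apply/subsetP=> h /setIdP[].
    apply/subsetP=> a Aa; apply/setIdP; split; first exact: (subsetP sAG).
    by apply/forall_inP=> t St; apply: SA.
  move=> x gx; have [Tx _ _] := goodP x gx.
  apply/setIdP; split; first exact: cubed_in Tx.
  by apply/forall_inP=> t St; apply: Sgood.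
have : g \in M by rewrite MG.
by case/setIdP=> _ /forall_inP; apply.
Qed.

Lemma comm_maximal_central : {in A & G, forall a g, [~ a, g] \in 'Z(G)}.
Proof.
apply: comm_good => //; first exact: sAG.
  by move=> a b Aa Ab; have /commgP/eqP-> := centsP abA _ Aa _ Ab; apply: group1.
move=> a Aa x gx; have [z Zz [_ ->//]] := good_comm gx.
by case: ifP.
Qed.

(** Take a in A with r = a x y cubed.  Modulo Z(G), a is central of order at most
    2, so the central element r^2 is congruent to (x y)^2, and hence to the
    commutator of x and y^-1. *)
Lemma comm_cubed_central : {in T &, forall x y, [~ x, y] \in 'Z(G)}.
Proof.
suff cV x y : x \in T -> y \in T -> [~ x, y^-1] \in 'Z(G).
  by move=> x y Tx Ty; rewrite -[y]invgK cV ?cubed_inv.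
move=> Tx Ty; have Gx := cubed_in Tx; have Gy := cubed_in Ty.
have Gxy : x * y \in G by apply: groupM.
have [a Aa Tr] := coset_meets_cubed Gxy.
have Z2 : (x * y) ^+ 2 \in 'Z(G).
  have -> : (x * y) ^+ 2 = (a ^+ 2 * [~ a, (x * y)^-1])^-1 * (a * (x * y)) ^+ 2.
    by reduce_words.
  rewrite groupM ?groupV // ?sqZ // groupM ?sqZ ?(subsetP sAT) //.
  by rewrite comm_maximal_central // groupV.
have -> : [~ x, y^-1] = x ^- 2 * (x * y) ^+ 2 * y ^- 2 by reduce_words.
by do 2?[apply: groupM]; rewrite ?groupV ?Z2 ?sqZ.
Qed.

Lemma comm_central : {in G &, forall g k, [~ g, k] \in 'Z(G)}.
Proof.
have cT : {in T & G, forall t g, [~ t, g] \in 'Z(G)}.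
  apply: comm_good => //; first exact: cubed_subset.
    by move=> t a Tt Aa; apply: comm_cubed_central => //; apply: (subsetP sAT).
  by move=> t Tt x /goodP[Tx _ _]; apply: comm_cubed_central.
apply: comm_good => //.
  by move=> g a Gg Aa; rewrite -groupV invg_comm cT // (subsetP sAT).
by move=> g Gg x /goodP[Tx _ _]; rewrite -groupV invg_comm cT.
Qed.

Lemma sqr_central : {in G, forall g, g ^+ 2 \in 'Z(G)}.
Proof.
move=> g Gg; have [a Aa Tag] := coset_meets_cubed Gg.
have -> : g ^+ 2 = (a ^+ 2 * [~ a, g^-1])^-1 * (a * g) ^+ 2 by reduce_words.
rewrite groupM ?groupV // ?sqZ // groupM ?sqZ ?(subsetP sAT) //.
by apply: comm_central; [exact: (subsetP sAG) | rewrite groupV].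
Qed.

Lemma comm_sqr g k : g \in G -> k \in G -> [~ g, k] ^+ 2 = 1.
Proof.
move=> Gg Gk; apply: comm_sqr_trivial; apply: (@central_comm _ G) => //.
  exact: comm_central.
exact: sqr_central.
Qed.

Lemma comm_sym g k : g \in G -> k \in G -> [~ k, g] = [~ g, k].
Proof. by move=> Gg Gk; apply: comm_swap; apply: comm_sqr. Qed.

Lemma comm_mul_l g h k :
  g \in G -> h \in G -> k \in G -> [~ g * h, k] = [~ g, k] * [~ h, k].
Proof.
move=> Gg Gh Gk; rewrite commMgJ; congr (_ * _).
by apply/conjg_fixP/commgP; apply: (central_comm _ Gh); apply: comm_central.
Qed.

Lemma comm_mul_r g h k :
  g \in G -> h \in G -> k \in G -> [~ k, g * h] = [~ k, g] * [~ k, h].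
Proof.
move=> Gg Gh Gk.
by rewrite comm_sym ?groupM // comm_mul_l // !(comm_sym Gk).
Qed.

Lemma cube_mul g k : g \in G -> k \in G -> (g * k) ^+ 3 = g ^+ 3 * k ^+ 3 * [~ g, k].
Proof.
move=> Gg Gk; have cZ h : h \in G -> commute h [~ k, g].
  by move=> Gh; apply/commute_sym; apply: (central_comm _ Gh); apply: comm_central.
rewrite expMg_Rmul; try exact: cZ.
congr (_ * _); have -> : 'C(3, 2) = 3 by [].
by rewrite (comm_sym Gg Gk) expgSr comm_sqr // mul1g.
Qed.

(** Cubing is additive up to the commutator, and alpha is a homomorphism, so a
    cubed a x y forces the two commutators to cancel. *)
Lemma comm_cubed_coset a x y :
    a \in A -> x \in T -> y \in T -> a * (x * y) \in T ->
  [~ x, y] = [~ a, x] * [~ a, y].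
Proof.
move=> Aa Tx Ty Taxy; have Ta := subsetP sAT _ Aa.
have Ga := cubed_in Ta; have Gx := cubed_in Tx; have Gy := cubed_in Ty.
have Gxy : x * y \in G by apply: groupM.
have := cubed_aut Taxy; rewrite !(aut_mul autG) // (cubed_aut Ta) (cubed_aut Tx).
rewrite (cubed_aut Ty) (cube_mul Ga Gxy) (cube_mul Gx Gy).
rewrite -[RHS]mulgA => /mulgI; rewrite -[RHS]mulgA -[LHS]mulg1 => /mulgI E.
apply: (mulIg [~ a, x * y]); rewrite -E -comm_mul_r //.
by rewrite -(comm_sqr Ga Gxy) expgS expg1.
Qed.

Lemma good_separate x y :
  good x -> good y -> y \notin A :* x -> exists2 a, a \in 'C_A[x] & a \notin 'C[y].
Proof.
move=> gx /goodP[Ty nAy _] nAxy; apply/subsetPn/negP=> sC.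
by case: (good_cent gx (cubed_in Ty) sC) => [Ay | Axy]; [case/negP: nAy | case/negP: nAxy].
Qed.

Let value x z := [/\ good x, z \in 'Z(G), z != 1 &
   {in A, forall a, [~ a, x] = if a \in 'C[x] then 1 else z}].

Lemma good_value x : good x -> exists z, value x z.
Proof. by move=> gx; have [z Zz [nz1 zE]] := good_comm gx; exists z. Qed.

(** For a in A centralizing x but not y, [a, r] = [a, y]. *)
Lemma value_mul x y r zy zr :
    good x -> value y zy -> value r zr -> r \in A :* (x * y) -> y \notin A :* x ->
  zy = zr.
Proof.
move=> gx [gy Zzy nzy zyE] [gr Zzr nzr zrE] /rcosetP[b Ab rE] nAxy.
have [a /setIP[Aa cax] nCa] := good_separate gx gy nAxy.
have Ga := subsetP sAG _ Aa; have Gb := subsetP sAG _ Ab.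
have [[Tx _ _] [Ty _ _]] := (goodP x gx, goodP y gy).
have Gx := cubed_in Tx; have Gy := cubed_in Ty.
have ax : [~ a, x] = 1 by apply/eqP/commgP/cent1P.
have ab : [~ a, b] = 1 by apply/eqP/commgP/(centsP abA).
have : [~ a, r] = zy.
  by rewrite rE !comm_mul_r ?groupM // ab ax !mul1g zyE // (negPf nCa).
by rewrite zrE //; case: ifP => // _ /eqP; rewrite eq_sym (negPf nzy).
Qed.

Lemma exists_good : exists x, good x.
Proof.
case: (pickP good) => [x gx | no_good]; first by exists x.
have AG : A :=: G.
  by apply: good_generate (subxx A) _; [exact: sAG | move=> x; rewrite no_good].
by case/negP: nabG; rewrite -AG.
Qed.

Lemma derived_cyclic z :
    z \in 'Z(G) -> z != 1 -> (exists x, value x z) ->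
    (forall x, good x -> {in A, forall a, [~ a, x] \in <[z]>}) ->
  #[z] = 2 /\ G^`(1) = <[z]>.
Proof.
move=> Zz nz [x [gx _ _ zE]] goodz.
have sWZ : <[z]> \subset 'Z(G) by rewrite cycle_subG.
have [Tx nAx _] := goodP x gx; have Gx := cubed_in Tx.
have [a Aa nCa] : exists2 a, a \in A & a \notin 'C[x].
  by apply/subsetPn; apply: contra nAx => sAC; apply: maximal_contains sAC.
have Ga := subsetP sAG _ Aa.
have za : z = [~ a, x] by rewrite zE // (negPf nCa).
have oz : #[z] = 2.
  by apply: nt_prime_order => //; rewrite za comm_sqr.
split=> //.
have cA : {in A & G, forall b g, [~ b, g] \in <[z]>}.
  apply: comm_good => //; first exact: sAG.
    by move=> b c Ab Ac; have /commgP/eqP-> := centsP abA _ Ab _ Ac; apply: group1.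
  by move=> b Ab y gy; apply: goodz.
have cT : {in T & G, forall t g, [~ t, g] \in <[z]>}.
  apply: comm_good => //; first exact: cubed_subset.
    by move=> t b Tt Ab; rewrite -groupV invg_comm cA // (cubed_in Tt).
  move=> t Tt y gy; have [Ty _ _] := goodP y gy.
  have Gt := cubed_in Tt; have Gy := cubed_in Ty.
  have [b Ab Tbty] := coset_meets_cubed (groupM Gt Gy).
  by rewrite (comm_cubed_coset Ab) // groupM // cA.
have cG : {in G & G, forall g k, [~ g, k] \in <[z]>}.
  apply: comm_good => //.
    by move=> g b Gg Ab; rewrite -groupV invg_comm cA.
  by move=> g Gg y /goodP[Ty _ _]; rewrite -groupV invg_comm cT.
apply/eqP; rewrite eqEsubset cycle_subG; apply/andP; split.
  by rewrite gen_subG; apply/subsetP=> _ /imset2P[g k Gg Gk ->]; apply: cG.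
by rewrite za mem_commg.
Qed.

Lemma central_of_commuting g x y :
   g \in G -> x \in G -> y \in G -> A \subset 'C[g] -> commute g x -> commute g y ->
  (forall k, k \in G -> exists2 e, k * e^-1 \in A & e \in <<[set x; y]>>) ->
  g \in 'Z(G).
Proof.
move=> Gg Gx Gy cAg cgx cgy GE; apply/centerP; split=> // k Gk.
have [e Ake Ee] := GE k Gk; apply/cent1P; rewrite cent1C -(mulgKV e k) groupM //.
  exact: (subsetP cAg).
suff sE : <<[set x; y]>> \subset 'C[g] by apply: (subsetP sE).
by rewrite gen_subG; apply/subsetP=> u /set2P[] ->; apply/cent1P/commute_sym.
Qed.

Lemma comm_coset a b x : a \in A -> b \in A -> x \in G -> [~ a, b * x] = [~ a, x].
Proof.
move=> Aa Ab Gx; rewrite comm_mul_r ?(subsetP sAG a) ?(subsetP sAG b) //.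
by have /commgP/eqP-> := centsP abA _ Aa _ Ab; rewrite mul1g.
Qed.

Lemma value_neq1 x z a : value x z -> a \in A -> [~ a, x] != 1 -> [~ a, x] = z.
Proof. by case=> _ _ _ zE Aa; rewrite zE //; case: ifP; rewrite ?eqxx. Qed.

Lemma value_witness x z : value x z -> exists2 a, a \in A & [~ a, x] = z.
Proof.
case=> /goodP[Tx nAx _] _ _ zE.
have [a Aa nCa] : exists2 a, a \in A & a \notin 'C[x].
  by apply/subsetPn; apply: contra nAx => sAC; apply: maximal_contains sAC.
by exists a; rewrite // zE // (negPf nCa).
Qed.

Lemma value_coset x y zx zy : value x zx -> value y zy -> y \in A :* x -> zx = zy.
Proof.
move=> vx vy /rcosetP[b Ab yE]; have [a Aa ax] := value_witness vx.
have [/goodP[/cubed_in Gx _ _] _ nzx _] := vx.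
have ay : [~ a, y] = zx by rewrite yE comm_coset.
by rewrite -ay; apply: value_neq1 => //; rewrite ay.
Qed.

(** Every other coset A w would consist of elements with both values: if w is
    good then so are A x w and A y w, because A x y is the one coset that is not
    good.  So G is the union of A, A x, A y and A x y.  Finally comm_cubed_coset,
    for a c in A with c x y cubed, tells how to modify x and y within their
    cosets to make them commute. *)
Lemma two_values x y zx zy :
    value x zx -> value y zy -> zx != zy ->
  exists x1 y1 a b,
    [/\ [/\ x1 \in G, y1 \in G, a \in G & b \in G],
        [/\ [~ x1, y1] = 1, [~ a, b] = 1, [~ a, y1] = 1 & [~ b, x1] = 1],
        [~ a, x1] = zx, [~ b, y1] = zy &
        G \subset <<[set a; b; x1; y1]>> <*> 'Z(G)].
Proof.
move=> vx vy nzxy.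
have [gx Zzx nzx zxE] := vx; have [gy Zzy nzy zyE] := vy.
have [Tx nAx iAx] := goodP x gx; have [Ty nAy iAy] := goodP y gy.
have Gx := cubed_in Tx; have Gy := cubed_in Ty.
have nAG := subsetP (normal_norm maximal_normal).
(* membership in a coset of A, on either side of a product *)
have cosetM u v w : u \in G -> v \in G -> w \in G -> (u * v \in A :* (u * w)) = (v \in A :* w).
  move=> Gu Gv Gw; rewrite !mem_rcoset.
  have -> : u * v * (u * w)^-1 = (v * w^-1) ^ u^-1 by reduce_words.
  by rewrite memJ_norm // groupV nAG.
have cosetC u v : u \in G -> v \in G -> u * v \in A :* (v * u).
  move=> Gu Gv; rewrite mem_rcoset.
  have -> : u * v * (v * u)^-1 = v ^ u^-1 * v^-1 by reduce_words.
  by rewrite conj_in_coset ?groupV.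
have prodA r u v : u \in G -> v \in G -> r \in A -> r \in A :* (u * v) -> v \in A :* u.
  move=> Gu Gv Ar /rcosetP[b Ab rE]; rewrite -(cosetM u) // mem_rcoset.
  have -> : u * v * (u * u)^-1 = b^-1 * r * u ^- 2 by rewrite rE; reduce_words.
  by rewrite groupM ?groupV ?sqr_in_maximal // groupM ?groupV.
have nAxy : y \notin A :* x by apply/negP=> /(value_coset vx vy) E; rewrite E eqxx in nzxy.
have nAyx : x \notin A :* y by rewrite rcoset_sym.
have [r Tr Axyr] : exists2 r, r \in T & r \in A :* (x * y).
  have [c Ac Tc] := coset_meets_cubed (groupM Gx Gy).
  by exists (c * (x * y)); rewrite // mem_rcoset mulgK.
have nAr : r \notin A by apply: contra nAxy => Ar; apply: prodA Axyr.
have ngr : ~~ good r.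
  apply/negP=> gr; have [z vr] := good_value gr.
  have E1 := value_mul gx vy vr Axyr nAxy.
  have E2 : zx = z.
    apply: (value_mul gy vx vr) nAyx.
    by rewrite rcoset_sym (rcoset_eqP Axyr) cosetC.
  by rewrite E1 E2 eqxx in nzxy.
have four g : g \in G -> [|| g \in A, g \in A :* x, g \in A :* y | g \in A :* (x * y)].
  move=> Gg; apply: contraT; rewrite !negb_or => /and4P[nAg nAxg nAyg nAxyg].
  have [c Ac Tw] := coset_meets_cubed Gg; set w := c * g in Tw.
  have Agw : w \in A :* g by rewrite mem_rcoset mulgK.
  have Gw := cubed_in Tw.
  have notin u : g \notin A :* u -> w \notin A :* u.
    by apply: contra => Auw; rewrite -(rcoset_eqP Auw) rcoset_sym.
  have nAw : w \notin A by rewrite groupMl.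
  have nAxyw := notin _ nAxyg.
  have gw : good w.
    apply: contraT => ngw; case/negP: nAxyw; rewrite -(rcoset_eqP Axyr).
    exact: not_good_unique.
  have [zw vw] := good_value gw.
  (* a good representative of the coset of u w forces u and w to have the same value *)
  have eqw u v zu : value u zu -> u \in G -> v \in G -> x * y \in A :* (u * v) -> w \notin A :* u ->
      w \notin A :* v -> zu = zw.
    move=> vu Gu Gv Auv nAuw nAvw.
    have [d Ad Ts] := coset_meets_cubed (groupM Gu Gw); set t := d * (u * w) in Ts.
    have Auwt : t \in A :* (u * w) by rewrite mem_rcoset mulgK.
    have gt : good t.
      apply: contraT => ngt; case/negP: nAvw; rewrite -(cosetM u) //.
      rewrite rcoset_sym -(rcoset_eqP Auwt) rcoset_sym.
      rewrite -(rcoset_eqP Auv) -(rcoset_eqP Axyr).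
      apply: not_good_unique => //.
      by apply: contra nAuw => At; apply: prodA Auwt.
    have [zt vt] := good_value gt.
    have [gu _ _ _] := vu.
    rewrite (value_mul gu vw vt Auwt nAuw).
    apply: (value_mul gw vu vt); last by rewrite rcoset_sym.
    by rewrite rcoset_sym (rcoset_eqP Auwt) cosetC.
  have E1 : zx = zw.
    by apply: (eqw x y) => //; [exact: rcoset_refl | exact: notin | exact: notin].
  have E2 : zy = zw.
    by apply: (eqw y x) => //; [exact: cosetC | exact: notin | exact: notin].
  by rewrite E1 E2 eqxx in nzxy.
have coverG k : k \in G -> exists2 e, k * e^-1 \in A & e \in <<[set x; y]>>.
  have Ex : x \in <<[set x; y]>> by rewrite mem_gen // set21.
  have Ey : y \in <<[set x; y]>> by rewrite mem_gen // set22.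
  move=> Gk; case/or4P: (four k Gk); rewrite ?mem_rcoset => Ak.
  - by exists 1; rewrite ?group1 // invg1 mulg1.
  - by exists x.
  - by exists y.
  by exists (x * y) => //; apply: groupM.
have [a /setIP[Aa /cent1P/commgP/eqP ay] nCa] := good_separate gy gx nAyx.
have [b /setIP[Ab /cent1P/commgP/eqP bx] nCb] := good_separate gx gy nAxy.
have ax : [~ a, x] = zx by rewrite zxE // (negPf nCa).
have b_y : [~ b, y] = zy by rewrite zyE // (negPf nCb).
have adjust d : d \in A -> exists e f, [/\ e \in A, f \in A, e \in <<[set a; b]>>, f \in <<[set a; b]>> &
    [/\ [~ e, x] = [~ d, x], [~ e, y] = 1, [~ f, x] = 1 & [~ f, y] = [~ d, y]]].
  move=> Ad; exists (if [~ d, x] == 1 then 1 else a), (if [~ d, y] == 1 then 1 else b).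
  have Ea : a \in <<[set a; b]>> by rewrite mem_gen // set21.
  have Eb : b \in <<[set a; b]>> by rewrite mem_gen // set22.
  split; try by case: ifP; rewrite ?group1.
  split; case: ifP; rewrite ?comm1g // => d1.
  - by rewrite (eqP d1).
  - by rewrite ax (value_neq1 vx) ?d1.
  - by rewrite (eqP d1).
  by rewrite b_y (value_neq1 vy) ?d1.
have [c Ac Tc] := coset_meets_cubed (groupM Gx Gy).
have [e [f [Ae Af _ _ [ex ey fx fy]]]] := adjust c Ac.
have GA := subsetP sAG; have [[[[Ga Gb] Gc] Ge] Gf] := (GA a Aa, GA b Ab, GA c Ac, GA e Ae, GA f Af).
have commA u v : u \in A -> v \in A -> [~ u, v] = 1.
  by move=> Au Av; apply/eqP/commgP/(centsP abA).
have sqc v : v \in G -> [~ c, v] * [~ c, v] = 1.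
  by move=> Gv; rewrite -(comm_sqr Gc Gv) expgS expg1.
exists (f * x), (e * y), a, b; split.
- by split=> //; apply: groupM.
- split; [| exact: commA | by rewrite comm_coset | by rewrite comm_coset].
  have Gey : e * y \in G by apply: groupM.
  rewrite comm_mul_l // comm_coset // comm_mul_r // (comm_sym Ge) // ex fy.
  rewrite (comm_cubed_coset Ac Tx Ty Tc) (mulgA [~ c, x]) sqc //.
  by rewrite mul1g sqc.
- by rewrite comm_coset.
- by rewrite comm_coset.
set M := _ <*> _.
have Min u : u \in [set a; b; f * x; e * y] -> u \in M.
  by move=> u4; rewrite mem_gen // inE mem_gen.
have sabM : <<[set a; b]>> \subset M.
  by rewrite gen_subG; apply/subsetP=> u /set2P[] ->; apply: Min; rewrite !inE eqxx ?orbT.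
have sAM : A \subset M.
  apply/subsetP=> d Ad; have [e1 [f1 [Ae1 Af1 Me1 Mf1 [ex1 ey1 fx1 fy1]]]] := adjust d Ad.
  have [[Gd Ge1] Gf1] := (GA d Ad, GA e1 Ae1, GA f1 Af1).
  have sq v : v \in G -> [~ d, v] * [~ d, v] = 1.
    by move=> Gv; rewrite -(comm_sqr Gd Gv) expgS expg1.
  have Zu : d * e1 * f1 \in 'Z(G).
    apply: (@central_of_commuting _ x y) => //; first by rewrite !groupM.
    - have Au : d * e1 * f1 \in A by rewrite !groupM.
      by rewrite sub_cent1 (subsetP abA).
    - by apply/commgP; rewrite !comm_mul_l ?groupM // ex1 fx1 mulg1 sq.
    by apply/commgP; rewrite !comm_mul_l ?groupM // ey1 fy1 mulg1 sq.
  have -> : d = d * e1 * f1 * f1^-1 * e1^-1 by rewrite !mulgK.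
  have Mu : d * e1 * f1 \in M by rewrite mem_gen // inE Zu orbT.
  by apply: groupM; [apply: groupM => // |]; rewrite groupV (subsetP sabM).
have Mx : x \in M.
  have Mfx : f * x \in M by apply: Min; rewrite !inE eqxx ?orbT.
  by rewrite -(mulKg f x) groupM // groupV (subsetP sAM).
have My : y \in M.
  have Mfx : e * y \in M by apply: Min; rewrite !inE eqxx ?orbT.
  by rewrite -(mulKg e y) groupM // groupV (subsetP sAM).
apply/subsetP=> k Gk; have [u Aku Eu] := coverG k Gk.
rewrite -(mulgKV u k); apply: groupM; first exact: (subsetP sAM).
suff sM : <<[set x; y]>> \subset M by apply: (subsetP sM).
by rewrite gen_subG; apply/subsetP=> v /set2P[] ->.
Qed.

Lemma class_two_dichotomy :
  (exists z, #[z] = 2 /\ G^`(1) = <[z]>) \/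
  (exists z1 z2 x y a b,
    [/\ [/\ z1 \in 'Z(G), z2 \in 'Z(G), z1 != 1, z2 != 1 & z1 != z2],
        [/\ x \in G, y \in G, a \in G & b \in G],
        [/\ [~ x, y] = 1, [~ a, b] = 1, [~ a, y] = 1 & [~ b, x] = 1],
        [~ a, x] = z1 /\ [~ b, y] = z2 &
        G \subset <<[set a; b; x; y]>> <*> 'Z(G)]).
Proof.
have [x0 gx0] := exists_good; have [z vz] := good_value gx0.
have [_ Zz nz _] := vz.
case: (pickP [pred x | good x && ~~ [forall a in A, [~ a, x] \in <[z]>]]) => [x | allz].
  case/andP=> gx; rewrite negb_forall_in => /exists_inP[a Aa nzax]; right.
  have [zx vx] := good_value gx; have [_ Zzx nzx _] := vx.
  have nzzx : z != zx.
    apply: contra nzax => /eqP zzx; have [-> | ax] := eqVneq [~ a, x] 1; first exact: group1.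
    by rewrite (value_neq1 vx Aa ax) -zzx cycle_id.
  have [x1 [y1 [a1 [b1 [P1 P2 P3 P4 P5]]]]] := two_values vz vx nzzx.
  by exists z, zx, x1, y1, a1, b1.
left; exists z; apply: derived_cyclic => //; first by exists x0.
move=> x gx a Aa; have := allz x; rewrite inE gx => /negbFE /forall_inP; exact.
Qed.

End NoAbelianIndexTwo.

End MaximalAbelian.

End CentralSquares.

(** * Symplectic bases *)

Section HyperbolicGenerators.

Variable gT : finGroupType.
Implicit Types (C S : {group gT}) (x a z g : gT).

Lemma quotient_generators S k (x a : 'I_k -> gT) :
    (forall i, x i \in S /\ a i \in S) ->
    S \subset <<[set x i | i : 'I_k] :|: [set a i | i : 'I_k]>> <*> 'Z(S) ->
  S / 'Z(S) = << [set coset 'Z(S) (x i) | i : 'I_k] :|: [set coset 'Z(S) (a i) | i : 'I_k] >>.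
Proof.
move=> xaS sS; set X := [set x i | i : 'I_k] in sS *; set Y := [set a i | i : 'I_k] in sS *.
have sXY : X :|: Y \subset S.
  by rewrite subUset; apply/andP; split; apply/subsetP=> _ /imsetP[i _ ->]; case: (xaS i).
have nZS : S \subset 'N('Z(S)) := normal_norm (center_normal S).
have SE : S :=: <<X :|: Y>> <*> 'Z(S).
  by apply/eqP; rewrite eqEsubset sS join_subG gen_subG sXY center_sub.
transitivity ((<<X :|: Y>> <*> 'Z(S)) / 'Z(S)); first by rewrite -SE.
rewrite quotientYidr ?gen_subG ?(subset_trans sXY) //.
rewrite quotient_gen ?(subset_trans sXY) //; congr <<_>>.
rewrite quotientE morphimEsub ?(subset_trans sXY) // imsetU.
by congr (_ :|: _); rewrite -imset_comp.
Qed.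

(** A symplectic basis: split off a noncommuting pair and recurse in its
    centralizer, which has the same centre. *)
Lemma hyperbolic_decomposition C z :
    z \in 'C(C) -> z ^+ 2 = 1 ->
    {in C &, forall g h, [~ g, h] = 1 \/ [~ g, h] = z} ->
  exists k (x a : 'I_k -> gT),
    [/\ forall i, x i \in C /\ a i \in C,
        C \subset <<[set x i | i : 'I_k] :|: [set a i | i : 'I_k]>> <*> 'Z(C),
        forall i j, i != j ->
          [/\ [~ x i, x j] = 1, [~ a i, a j] = 1 & [~ a i, x j] = 1]
      & forall i, [~ a i, x i] = z].
Proof.
move=> + z2; have [n] := ubnP #|C|; elim: n C => // n IHn C ltCn cCz commC.
have [abC | nabC] := boolP (abelian C).
  exists 0, (fun=> 1), (fun=> 1); split=> [[]//||[]//|[]//].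
  by rewrite (center_idP abC) joing_subr.
have [a0 Ca0] := subsetPn nabC; rewrite -sub_cent1 => /subsetPn[x0 Cx0 nxa].
have zE : [~ a0, x0] = z.
  by case: (commC a0 x0 Ca0 Cx0) => // /eqP/commgP cax; case/negP: nxa; apply/cent1P/commute_sym.
have cC g h k : g \in C -> h \in C -> k \in C -> commute [~ g, h] k.
  move=> Cg Ch Ck; case: (commC g h Cg Ch) => ->; first exact: commute_sym (commute1 k).
  exact: (centP cCz).
have commMl g h k : g \in C -> h \in C -> k \in C -> [~ g * h, k] = [~ g, k] * [~ h, k].
  move=> Cg Ch Ck; rewrite commMgJ; congr (_ * _).
  by apply/conjg_fixP/commgP/cC.
have xaE : [~ x0, a0] = z.
  by rewrite comm_swap zE.
pose D := ('C_('C_C[a0])[x0])%G.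
have DP d : reflect [/\ d \in C, [~ d, a0] = 1 & [~ d, x0] = 1] (d \in D).
  rewrite !in_setI -andbA; apply: (iffP and3P) => [[Cd /cent1P/commgP/eqP ? /cent1P/commgP/eqP ?]|].
    by [].
  by case=> Cd /eqP/commgP ? /eqP/commgP ?; split=> //; apply/cent1P.
have sDC : D \subset C by apply/subsetP=> d /DP[].
(* any element of C becomes an element of D after multiplication by powers of a0 and x0 *)
have adjust g : g \in C -> exists e f, [/\ e \in [set 1; a0], f \in [set 1; x0] & g * e * f \in D].
  move=> Cg.
  have gE h : h \in C -> [~ g, h] != 1 -> [~ g, h] = z.
    by move=> Ch; case: (commC g h Cg Ch) => ->; rewrite ?eqxx.
  have sq h : h \in C -> [~ g, h] * [~ g, h] = 1.
    by move=> Ch; case: (commC g h Cg Ch) => ->; rewrite ?mulg1.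
  have [e [He Ce ea ex]] : exists e,
      [/\ e \in [set 1; a0], e \in C, [~ e, a0] = 1 & [~ e, x0] = [~ g, x0]].
    have [g1 | /(gE _ Cx0) g1] := eqVneq [~ g, x0] 1.
      by exists 1; rewrite set21 group1 g1 !comm1g.
    by exists a0; rewrite set22 Ca0 g1 zE commgg.
  have [f [Hf Cf fx fa]] : exists f,
      [/\ f \in [set 1; x0], f \in C, [~ f, x0] = 1 & [~ f, a0] = [~ g, a0]].
    have [g1 | /(gE _ Ca0) g1] := eqVneq [~ g, a0] 1.
      by exists 1; rewrite set21 group1 g1 !comm1g.
    by exists x0; rewrite set22 Cx0 g1 xaE commgg.
  have Cge : g * e \in C by apply: groupM.
  exists e, f; split=> //; apply/DP; split; first exact: groupM.
    by rewrite (commMl _ _ _ Cge Cf Ca0) (commMl _ _ _ Cg Ce Ca0) ea fa mulg1 sq.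
  by rewrite (commMl _ _ _ Cge Cf Cx0) (commMl _ _ _ Cg Ce Cx0) ex fx mulg1 sq.
have ltDC : #|D| < #|C|.
  apply: proper_card; rewrite properE sDC; apply/subsetPn; exists a0 => //.
  by apply/negP=> /DP[_ _ /eqP/commgP ca]; case/negP: nxa; apply/cent1P/commute_sym.
have [k [x [a [xaD sD offdiag diag]]]] : exists k (x a : 'I_k -> gT),
    [/\ forall i, x i \in D /\ a i \in D,
        D \subset <<[set x i | i : 'I_k] :|: [set a i | i : 'I_k]>> <*> 'Z(D),
        forall i j, i != j ->
          [/\ [~ x i, x j] = 1, [~ a i, a j] = 1 & [~ a i, x j] = 1]
      & forall i, [~ a i, x i] = z].
  apply: IHn; first exact: leq_trans ltDC _.
    exact: subsetP (centS sDC) _ cCz.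
  by move=> g h Dg Dh; apply: commC; apply: (subsetP sDC).
have DC g : g \in D -> g \in C := subsetP sDC g.
pose X (i : 'I_k.+1) := oapp x x0 (unlift ord0 i).
pose Y (i : 'I_k.+1) := oapp a a0 (unlift ord0 i).
exists k.+1, X, Y.
have X0 : X ord0 = x0 by rewrite /X unlift_none.
have Y0 : Y ord0 = a0 by rewrite /Y unlift_none.
have XS i : X (lift ord0 i) = x i by rewrite /X liftK.
have YS i : Y (lift ord0 i) = a i by rewrite /Y liftK.
have off g : g \in D -> [/\ [~ g, x0] = 1, [~ g, a0] = 1, [~ x0, g] = 1 & [~ a0, g] = 1].
  by case/DP=> _ ga gx; split=> //; apply/eqP; rewrite commg1_sym; apply/eqP.
split.
- move=> i; case: (unliftP ord0 i) => [j|] ->; rewrite ?XS ?YS ?X0 ?Y0 //.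
  by have [/DC ? /DC ?] := xaD j.
- set M := _ <*> _.
  have MX i : X i \in M by rewrite mem_gen // inE mem_gen // inE imset_f.
  have MY i : Y i \in M by rewrite mem_gen // inE mem_gen // inE imset_f ?orbT.
  have MZ u : u \in 'Z(C) -> u \in M by move=> Zu; rewrite mem_gen // inE Zu orbT.
  have MDZ u : u \in 'Z(D) -> u \in M.
    case/centerP=> Du cu; apply: MZ; apply/centerP; split=> [|g Cg]; first exact: DC.
    have [e [f [He Hf Dg]]] := adjust g Cg; have [ux ua _ _] := off u Du.
    have cue : commute u e by case/set2P: He => ->; [apply: commute1 | apply/commgP/eqP].
    have cuf : commute u f by case/set2P: Hf => ->; [apply: commute1 | apply/commgP/eqP].
    have -> : g = g * e * f * f^-1 * e^-1 by rewrite !mulgK.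
    by apply: commuteM; [apply: commuteM; [apply: cu|apply: commuteV] | apply: commuteV].
  have MD : D \subset M.
    apply: subset_trans sD _; rewrite join_subG gen_subG subUset -andbA; apply/and3P; split.
    + by apply/subsetP=> _ /imsetP[i _ ->]; rewrite -XS.
    + by apply/subsetP=> _ /imsetP[i _ ->]; rewrite -YS.
    by apply/subsetP=> u /MDZ.
  apply/subsetP=> g Cg; have [e [f [He Hf Dg]]] := adjust g Cg.
  have -> : g = g * e * f * f^-1 * e^-1 by rewrite !mulgK.
  have Me : e \in M by case/set2P: He => ->; rewrite ?group1 // -Y0.
  have Mf : f \in M by case/set2P: Hf => ->; rewrite ?group1 // -X0.
  by rewrite groupM ?groupV // groupM ?groupV // (subsetP MD).
- move=> i j; case: (unliftP ord0 i) => [i1|] ->; case: (unliftP ord0 j) => [j1|] ->.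
  + by rewrite (inj_eq (lift_inj (h := ord0))) !XS !YS; apply: offdiag.
  + have [/off[? ? ? ?] /off[? ? ? ?]] := xaD i1; by rewrite XS YS X0 Y0.
  + have [/off[? ? ? ?] /off[? ? ? ?]] := xaD j1; by rewrite XS YS X0 Y0.
  by rewrite eqxx.
by move=> i; case: (unliftP ord0 i) => [j|] ->; rewrite ?XS ?YS ?X0 ?Y0.
Qed.

End HyperbolicGenerators.

(** * The Sylow 2-subgroup of a group of class two *)

Section ClassTwo.

Variables (gT : finGroupType) (G : {group gT}).
Implicit Types (x y a b z g : gT) (L S P : {group gT}).

Hypothesis nabG : ~~ abelian G.
Hypothesis commZ : {in G &, forall g k, [~ g, k] \in 'Z(G)}.
Hypothesis sqrZ : {in G, forall g, g ^+ 2 \in 'Z(G)}.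
Hypothesis coZ : coprime #|'Z(G)| 3.

Lemma odd_order_central x : x \in G -> coprime #[x] 2 -> x \in 'Z(G).
Proof. by move=> Gx co2; apply: coprime_root_in co2 _; apply: sqrZ. Qed.

Lemma class_two_coprime : coprime #|G| 3.
Proof.
rewrite coprime_sym prime_coprime //; apply/negP=> /Cauchy[] // x Gx ox.
have Zx : x \in 'Z(G) by rewrite odd_order_central // ox.
have := order_dvdG Zx; rewrite ox => d3.
by have := coZ; rewrite coprime_sym prime_coprime // d3.
Qed.

Lemma derived_central : G^`(1) \subset 'Z(G).
Proof. by rewrite gen_subG; apply/subsetP=> _ /imset2P[g k Gg Gk ->]; apply: commZ. Qed.

Lemma class_two_class : nil_class G = 2.
Proof.
have := nil_class2 G; rewrite derived_central => le2.
by apply/eqP; rewrite eqn_leq le2 ltnNge nil_class1.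
Qed.

Lemma class_two_nilpotent : nilpotent G.
Proof. by apply: small_nil_class; rewrite class_two_class. Qed.

Lemma class_two_odd_Sylow p P : prime p -> 2 < p -> p.-Sylow(G) P -> abelian P.
Proof.
move=> pr_p p2 sylP; have sPG := pHall_sub sylP.
suff sPZ : P \subset 'Z(G) by apply: abelianS sPZ (center_abelian G).
apply/subsetP=> x Px; apply: odd_order_central; first exact: (subsetP sPG).
have px := mem_p_elt (pHall_pgroup sylP) Px.
rewrite (pnat_coprime px) // p'natE // gtnNdvd //.
Qed.

Section SylowTwo.

Variable S : {group gT}.
Hypothesis sylS : 2.-Sylow(G) S.

Let sSG : S \subset G := pHall_sub sylS.

Lemma two_part_in_Sylow g : g \in G -> g.`_2 \in S.
Proof.
move=> Gg; have nS : S <| G.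
  by rewrite (nilpotent_Hall_pcore class_two_nilpotent sylS) pcore_normal.
by rewrite (mem_normal_Hall sylS nS) ?p_elt_constt // groupX.
Qed.

Lemma odd_part_central g : g \in G -> g.`_2^' \in 'Z(G).
Proof.
move=> Gg; apply: odd_order_central; first exact: groupX.
have : 2^'.-elt g.`_2^' by apply: p_elt_constt.
by rewrite /p_elt p'natE // => n2; rewrite coprime_sym prime_coprime.
Qed.

Lemma comm_two_part g k : g \in G -> k \in G -> [~ g.`_2, k.`_2] = [~ g, k].
Proof.
move=> Gg Gk.
have part h u : h \in G -> u \in G -> [~ u, h.`_2] = [~ u, h].
  move=> Gh Gu; rewrite -[in RHS](consttC 2 h) commgMJ.
  have /centerP[_ cZ] := odd_part_central Gh.
  have -> : [~ u, h.`_2^'] = 1 by apply/eqP/commgP/commute_sym/cZ.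
  by rewrite mul1g; apply/esym/conjg_fixP/commgP/commute_sym/cZ; rewrite groupR ?groupX.
by rewrite part // ?groupX // -[LHS]invg_comm part // invg_comm.
Qed.

Lemma center_Sylow : S :&: 'Z(G) \subset 'Z(S).
Proof.
apply/subsetP=> x /setIP[Sx /centerP[_ cx]]; apply/centerP; split=> // y Sy.
by apply: cx; apply: (subsetP sSG).
Qed.

Lemma Sylow_abelem : 2.-abelem (S / 'Z(S)).
Proof.
have sSZ x : x \in S -> x \in 'Z(G) -> x \in 'Z(S).
  by move=> Sx Zx; apply: (subsetP center_Sylow); rewrite inE Sx.
apply/abelemP=> //; split.
  apply: sub_der1_abelian; rewrite gen_subG; apply/subsetP=> _ /imset2P[g k Sg Sk ->].
  by apply: sSZ; [exact: groupR | rewrite commZ // (subsetP sSG)].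
move=> _ /morphimP[x Nx Sx ->]; rewrite -morphX //; apply: coset_id.
by apply: sSZ; [exact: groupX | rewrite sqrZ // (subsetP sSG)].
Qed.

Lemma derived_Sylow : S^`(1) = G^`(1).
Proof.
apply/eqP; rewrite eqEsubset dergS //= gen_subG.
apply/subsetP=> _ /imset2P[g k Gg Gk ->].
by rewrite -comm_two_part // mem_commg ?two_part_in_Sylow.
Qed.

Lemma structureIIIi_of_cyclic z : #[z] = 2 -> G^`(1) = <[z]> -> structureIIIi S.
Proof.
move=> oz dG; have dS : S^`(1) = <[z]> by rewrite derived_Sylow.
have Zz : z \in 'Z(G) by apply: (subsetP derived_central); rewrite dG cycle_id.
have z2 : z ^+ 2 = 1 by rewrite -oz expg_order.
have cSz : z \in 'C(S).
  by have /setIP[_] := Zz; apply: (subsetP (centS sSG)).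
have commS : {in S &, forall g h, [~ g, h] = 1 \/ [~ g, h] = z}.
  move=> g h Sg Sh; have : [~ g, h] \in <[z]> by rewrite -dS mem_commg.
  by rewrite cycle2g // => /set2P.
have [k [x [a [xaS sS offdiag diag]]]] := hyperbolic_decomposition cSz z2 commS.
exists z, k, x, a; split=> //; first exact: Sylow_abelem.
  rewrite lt0n; apply/eqP=> k0; subst k.
  have abS : abelian S.
    apply: abelianS sS _.
    have -> : [set x i | i : 'I_0] :|: [set a i | i : 'I_0] = set0.
      by apply/setP=> u; rewrite !inE; apply/negbTE; rewrite negb_or; apply/andP; split;
         apply/imsetP=> -[[]].
    by rewrite gen0 joing1G center_abelian.
  have : z \in S^`(1) by rewrite dS cycle_id.
  by rewrite (derG1P abS) => /set1P z1; rewrite z1 order1 in oz.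
by split=> //; apply: quotient_generators.
Qed.

(** The centralizers of a, of a and b, of a, b and x, and of all four have index
    2 each in the preceding one and end at Z(S); this gives |S : Z(S)| = 16. *)
Lemma structureIIIii_of_pairs z1 z2 x y a b :
    [/\ z1 \in 'Z(G), z2 \in 'Z(G), z1 != 1, z2 != 1 & z1 != z2] ->
    [/\ x \in S, y \in S, a \in S & b \in S] ->
    [/\ [~ x, y] = 1, [~ a, b] = 1, [~ a, y] = 1 & [~ b, x] = 1] ->
    [~ a, x] = z1 -> [~ b, y] = z2 ->
    S \subset <<[set a; b; x; y]>> <*> 'Z(S) ->
  structureIIIii S.
Proof.
case=> Zz1 Zz2 nz1 nz2 nz12 [Sx Sy Sa Sb] [xy ab ay bx] ax b_y sS.
have GS := subsetP sSG; have [Gx Gy Ga Gb] := And4 (GS x Sx) (GS y Sy) (GS a Sa) (GS b Sb).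
have SZ z : z \in S -> z \in 'Z(G) -> z \in 'Z(S).
  by move=> Sz Zz; apply: (subsetP center_Sylow); rewrite inE Sz.
have swap g k : [~ g, k] = 1 -> [~ k, g] = 1.
  by move=> gk; rewrite -invg_comm gk invg1.
have sq g k z : g \in G -> k \in G -> [~ g, k] = z -> z ^+ 2 = 1.
  move=> Gg Gk <-; apply: comm_sqr_trivial; apply: (@central_comm _ G) => //.
    exact: commZ.
  exact: sqrZ.
have z12 := sq _ _ _ Ga Gx ax; have z22 := sq _ _ _ Gb Gy b_y.
have oz1 : #[z1] = 2 by apply: nt_prime_order.
have oz2 : #[z2] = 2 by apply: nt_prime_order.
have swapz g k z : z ^+ 2 = 1 -> [~ g, k] = z -> [~ k, g] = z.
  by move=> zz gk; rewrite comm_swap gk.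
have xa := swapz _ _ _ z12 ax; have yb := swapz _ _ _ z22 b_y.
have Szz1 : z1 \in 'Z(S) by rewrite SZ // -ax groupR.
have Szz2 : z2 \in 'Z(S) by rewrite SZ // -b_y groupR.
have commW (V : {set gT}) (W : {group gT}) : V \subset S -> W \subset 'Z(S) ->
    {in V, forall v, [/\ [~ v, a] \in W, [~ v, b] \in W, [~ v, x] \in W & [~ v, y] \in W]} ->
  {in V & S, forall v g, [~ v, g] \in W}.
  move=> sVS sWZ VW v g Vv Sg.
  pose M := Group (comm_central_group_set sVS sWZ (groupP W)).
  have inM k : k \in S -> {in V, forall u, [~ u, k] \in W} -> k \in M.
    by move=> Sk Vk; apply/setIdP; split=> //; apply/forall_inP.
  suff sSM : S \subset M by have /setIdP[_ /forall_inP->] := subsetP sSM g Sg.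
  apply: subset_trans sS _; rewrite join_subG gen_subG; apply/andP; split.
    apply/subsetP=> k; rewrite !in_setU !in_set1 -!orbA => /or4P[] /eqP->; apply: inM => // u Vu;
    by case: (VW u Vu).
  apply/subsetP=> k /centerP[Sk ck]; apply: inM => // u Vu.
  have -> : [~ u, k] = 1; last exact: group1.
  by apply/eqP/commgP/commute_sym/ck/(subsetP sVS).
have comm2 v z : z \in 'Z(S) -> #[z] = 2 -> v \in S ->
    [/\ [~ v, a] \in <[z]>, [~ v, b] \in <[z]>, [~ v, x] \in <[z]> & [~ v, y] \in <[z]>] ->
    {in S, forall k, [~ v, k] = 1 \/ [~ v, k] = z}.
  move=> Zz oz Sv vW k Sk; apply/set2P; rewrite -cycle2g //.
  apply: (commW [set v]) => //; rewrite ?sub1set ?cycle_subG ?set11 //.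
  by move=> u /set1P->.
have ca : {in S, forall k, [~ a, k] = 1 \/ [~ a, k] = z1}.
  by apply: comm2 => //; rewrite commgg ab ax ay cycle_id !group1.
have cb : {in S, forall k, [~ b, k] = 1 \/ [~ b, k] = z2}.
  by apply: comm2 => //; rewrite commgg (swap _ _ ab) bx b_y cycle_id !group1.
have cx : {in S, forall k, [~ x, k] = 1 \/ [~ x, k] = z1}.
  by apply: comm2 => //; rewrite commgg xa (swap _ _ bx) xy cycle_id !group1.
have cy : {in S, forall k, [~ y, k] = 1 \/ [~ y, k] = z2}.
  by apply: comm2 => //; rewrite commgg yb (swap _ _ ay) (swap _ _ xy) cycle_id !group1.
have cz12 : <[z2]> \subset 'C(<[z1]>).
  rewrite cycle_subG; apply/centP=> u; move: u; apply/centP.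
  have /setIP[_] := Szz2; apply: (subsetP (centS _)).
  by rewrite cycle_subG; case/setIP: Szz1.
have tiz : <[z1]> :&: <[z2]> = 1.
  by rewrite !cycle2g //; apply/setP=> u; rewrite !inE; case: (eqVneq u 1) => //= _;
     case: (eqVneq u z1) => // ->; rewrite (negPf nz12).
have dS : <[z1]> \x <[z2]> = S^`(1).
  rewrite dprodEY //; apply/eqP; rewrite eqEsubset; apply/andP; split.
    by rewrite join_subG !cycle_subG -{1}ax -b_y !mem_commg.
  rewrite gen_subG; apply/subsetP=> _ /imset2P[g k Sg Sk ->].
  pose W := (<[z1]> <*> <[z2]>)%G.
  have W1 : z1 \in W by rewrite mem_gen // inE cycle_id.
  have W2 : z2 \in W by rewrite mem_gen // inE cycle_id orbT.
  have sWZ : W \subset 'Z(S) by rewrite join_subG !cycle_subG Szz1.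
  apply: (commW S W) => // v Sv.
  split; rewrite -groupV invg_comm.
  - by case: (ca v Sv) => ->; rewrite ?group1.
  - by case: (cb v Sv) => ->; rewrite ?group1.
  - by case: (cx v Sv) => ->; rewrite ?group1.
  by case: (cy v Sv) => ->; rewrite ?group1.
have halve (L : {group gT}) g k z : L \subset S -> {in S, forall k, [~ g, k] = 1 \/ [~ g, k] = z} ->
    k \in L -> [~ g, k] = z -> z != 1 -> #|L| = (2 * #|'C_L[g]|)%N.
  move=> sLS cg Lk gk nz.
  rewrite -(Lagrange (subsetIl L 'C[g])) index_cent1 mulnC; congr (_ * _)%N.
  have -> : g ^: L = [set g; g * z].
    apply/setP=> u; apply/imsetP/set2P=> [[h Lh ->] | [] ->].
    - have := cg h (subsetP sLS h Lh); rewrite commgEl.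
      by case=> /(congr1 (mulg g)); rewrite mulKVg ?mulg1 => ->; [left | right].
    - by exists 1; rewrite ?conjg1.
    by exists k; rewrite // -gk commgEl mulKVg.
  by rewrite cards2 -[X in X == _]mulg1 (inj_eq (mulgI g)) eq_sym nz.
pose L1 := 'C_S[a]%G; pose L2 := 'C_L1[b]%G; pose L3 := 'C_L2[x]%G; pose L4 := 'C_L3[y]%G.
have in_cent (L : {group gT}) g k : k \in L -> [~ g, k] = 1 -> k \in 'C_L[g].
  by move=> Lk gk; rewrite inE Lk; apply/cent1P/commute_sym/commgP/eqP.
have sL1 : L1 \subset S := subsetIl _ _.
have sL2 : L2 \subset S := subset_trans (subsetIl _ _) sL1.
have sL3 : L3 \subset S := subset_trans (subsetIl _ _) sL2.
have E1 : #|S| = (2 * #|L1|)%N by apply: (halve S a x z1).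
have E2 : #|L1| = (2 * #|L2|)%N by apply: (halve L1 b y z2) => //; apply: in_cent.
have aL2 : a \in L2 := in_cent L1 b a (in_cent S a a Sa (commgg a)) (swap _ _ ab).
have bL2 : b \in L2 := in_cent L1 b b (in_cent S a b Sb ab) (commgg b).
have bL3 : b \in L3 := in_cent L2 x b bL2 (swap _ _ bx).
have E3 : #|L2| = (2 * #|L3|)%N by apply: (halve L2 x a z1).
have E4 : #|L3| = (2 * #|L4|)%N by apply: (halve L3 y b z2).
have ZL4 : L4 :=: 'Z(S).
  apply/eqP; rewrite eqEsubset; apply/andP; split; last first.
    apply/subsetP=> u /centerP[Su cu].
    have cu1 g : g \in S -> [~ g, u] = 1 by move=> Sg; apply/eqP/commgP/commute_sym/cu.
    have uL2 := in_cent L1 b u (in_cent S a u Su (cu1 a Sa)) (cu1 b Sb).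
    exact: in_cent L3 y u (in_cent L2 x u uL2 (cu1 x Sx)) (cu1 y Sy).
  apply/subsetP=> u /setIP[/setIP[/setIP[/setIP[Su ua] ub] ux] uy].
  apply/centerP; split=> // g Sg; apply/cent1P; rewrite cent1C; move: g Sg; apply/subsetP.
  apply: subset_trans sS _; rewrite join_subG gen_subG; apply/andP; split.
    by apply/subsetP=> k; rewrite !in_setU !in_set1 -!orbA => /or4P[] /eqP->; rewrite cent1C.
  by rewrite sub_cent1; apply: subsetP Su; rewrite centsC subIset // subxx orbT.
have o16 : #|S / 'Z(S)| = 16.
  rewrite card_quotient ?(normal_norm (center_normal S)) //.
  apply/eqP; rewrite -(eqn_pmul2l (cardG_gt0 'Z(S))) Lagrange ?center_sub //.
  by rewrite E1 E2 E3 E4 ZL4 !mulnA mulnC.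
pose two (u v : gT) (i : 'I_2) := if i == ord0 then u else v.
have two_cases (i : 'I_2) : i = ord0 \/ i = ord_max.
  by case: i => [[|[|//]] lti]; [left | right]; apply: val_inj.
exists (two z1 z2), (two x y), (two a b); split=> //.
- by move=> i; case: (two_cases i) => ->.
- exact: Sylow_abelem.
have xaS i : two x y i \in S /\ two a b i \in S by case: (two_cases i) => ->.
split=> //.
- apply: quotient_generators => //; apply: subset_trans sS _; apply: genS.
  apply: setSU; apply: genS; apply/subsetP=> k; rewrite !in_setU !in_set1 -!orbA.
  case/or4P=> /eqP->; apply/orP.
  + by right; apply/imsetP; exists ord0.
  + by right; apply/imsetP; exists ord_max.
  + by left; apply/imsetP; exists ord0.
  by left; apply/imsetP; exists ord_max.
- move=> i j; case: (two_cases i) => ->; case: (two_cases j) => -> //= _.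
  by split=> //; exact: swap.
by move=> i; case: (two_cases i) => ->.
Qed.

Lemma Sylow_generated x y a b :
    [/\ x \in G, y \in G, a \in G & b \in G] ->
    G \subset <<[set a; b; x; y]>> <*> 'Z(G) ->
  S \subset <<[set a.`_2; b.`_2; x.`_2; y.`_2]>> <*> 'Z(S).
Proof.
case=> Gx Gy Ga Gb sG; set U := <<_>>.
have sUS : U \subset S.
  rewrite gen_subG; apply/subsetP=> k; rewrite !in_setU !in_set1 -!orbA.
  by case/or4P=> /eqP->; apply: two_part_in_Sylow.
have cUZ : 'Z(G) \subset 'C(U).
  by rewrite (subset_trans (subsetIr _ _)) // centS // (subset_trans sUS).
have sGU : G \subset U <*> 'Z(G).
  apply: subset_trans sG _; rewrite join_subG joing_subr andbT gen_subG.
  have part k : k \in G -> k.`_2 \in U -> k \in U <*> 'Z(G).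
    move=> Gk Uk; rewrite -(consttC 2 k) groupM // mem_gen // inE ?Uk //.
    by rewrite odd_part_central ?orbT.
  apply/subsetP=> k; rewrite !in_setU !in_set1 -!orbA.
  by case/or4P=> /eqP->; apply: part => //; rewrite mem_gen // !inE eqxx ?orbT.
apply/subsetP=> s Ss; have := subsetP sGU s (subsetP sSG s Ss).
rewrite cent_joinEr // => /mulsgP[u c Uu Zc sE].
have Su := subsetP sUS u Uu.
rewrite sE groupM //; first by rewrite mem_gen // inE Uu.
rewrite mem_gen // inE (subsetP center_Sylow) ?orbT // inE Zc andbT.
by rewrite -(groupMl _ Su) -sE.
Qed.

End SylowTwo.

Lemma class_two_structureIII :
    (exists z, #[z] = 2 /\ G^`(1) = <[z]>) \/
    (exists z1 z2 x y a b,
      [/\ [/\ z1 \in 'Z(G), z2 \in 'Z(G), z1 != 1, z2 != 1 & z1 != z2],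
          [/\ x \in G, y \in G, a \in G & b \in G],
          [/\ [~ x, y] = 1, [~ a, b] = 1, [~ a, y] = 1 & [~ b, x] = 1],
          [~ a, x] = z1 /\ [~ b, y] = z2 &
          G \subset <<[set a; b; x; y]>> <*> 'Z(G)]) ->
  structureIII G.
Proof.
move=> dich; split; [exact: class_two_nilpotent | exact: class_two_class |
  exact: class_two_coprime | exact: class_two_odd_Sylow | ].
have [S sylS] := Sylow_exists 2 G; exists S; split=> //.
case: dich => [[z [oz dG]] | [z1 [z2 [x [y [a [b [Z12 Gxyab comms [ax b_y] sG]]]]]]]].
  by left; apply: structureIIIi_of_cyclic oz dG.
right; have [Gx Gy Ga Gb] := Gxyab.
have [xy ab ay bx] := comms.
apply: (structureIIIii_of_pairs sylS Z12 (x := x.`_2) (y := y.`_2) (a := a.`_2) (b := b.`_2)).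
- by split; apply: two_part_in_Sylow.
- by split; rewrite comm_two_part.
- by rewrite comm_two_part.
- by rewrite comm_two_part.
exact: Sylow_generated.
Qed.

End ClassTwo.

(** * Necessity *)

Section Necessity.

Variables (gT : finGroupType) (G : {group gT}) (alpha : {perm gT}).

Local Notation T := (cubed_set G alpha).

Lemma large_cubed_structure :
    alpha \in Aut G -> #|G| < 2 * #|T| ->
  [\/ structureI G, structureII G | structureIII G].
Proof.
move=> autG ltT; have TG : T :&: G = T by apply/setIidPl/cubed_subset.
have coZ : coprime #|'Z(G)| 3.
  by apply/(cubed_group_coprime autG)/(center_cubed autG); rewrite ?TG.
have [abG | nabG] := boolP (abelian G).
  by constructor 1; split=> //; rewrite -(center_idP abG).
case: (pickP [pred h in T | h ^+ 2 \notin 'Z(G)]) => [h /andP[Th nZh] | sqT].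
  by constructor 2; apply: noncentral_square_structureII ltT Th nZh.
have sqZ : {in T, forall h, h ^+ 2 \in 'Z(G)}.
  by move=> h Th; have := sqT h; rewrite inE Th => /negbFE.
case: (pickP [pred K : {group gT} | [&& K \subset G, #|G : K| == 2 & abelian K]]) => [K | noK].
  case/and3P=> sKG /eqP iGK abK; constructor 2.
  exact: structureII_index2 sKG iGK abK coZ.
have noII (K : {group gT}) : K \subset G -> #|G : K| = 2 -> ~~ abelian K.
  by move=> sKG iGK; have := noK K; rewrite inE sKG iGK eqxx => /negbT.
pose P := [pred A : {group gT} | abelian A & A \subset T].
have P1 : P 1%G by rewrite inE /= abelian1 sub1set cubed_one.
have [A /andP[abA sAT] maxA] := @arg_maxnP _ 1%G P (fun A : {group gT} => #|A|) P1.
have {}maxA (A' : {group gT}) : abelian A' -> A' \subset T -> #|A'| <= #|A|.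
  by move=> abA' sA'T; apply: maxA; rewrite inE abA'.
constructor 3; apply: class_two_structureIII => //.
- by apply: comm_central abA sAT maxA nabG noII.
- by apply: sqr_central abA sAT maxA nabG noII.
exact: class_two_dichotomy abA sAT maxA nabG noII.
Qed.

End Necessity.

(** * Sufficiency *)

Section Sufficiency.

Variables (gT : finGroupType) (G : {group gT}).
Implicit Types (A X K S P : {group gT}).

Lemma cube_ratio_gt (alpha : {perm gT}) :
  (1 / 2 < cube_ratio G alpha)%R = (#|G| < 2 * #|cubed_set G alpha|).
Proof.
have G0 : (0 < #|G|%:R :> rat)%R by rewrite ltr0n cardG_gt0.
rewrite /cube_ratio ltr_pdivlMr // mulrAC ltr_pdivrMr ?ltr0n // mul1r -natrM ltr_nat.
by rewrite mulnC.
Qed.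

Lemma automorphism_of (f : gT -> gT) :
    {in G &, {morph f : g h / g * h}} -> {in G, forall g, f g \in G} ->
    {in G, forall g, f g = 1 -> g = 1} ->
  exists2 alpha : {perm gT}, alpha \in Aut G & {in G, alpha =1 f}.
Proof.
move=> fM fG f1; pose phi := Morphism fM.
have injf : 'injm phi.
  by apply/subsetP=> g /morphpreP[Gg /set1P fg1]; apply/set1P/f1.
have Gf : phi @* G = G.
  apply/eqP; rewrite eqEcard card_injm // leqnn andbT.
  by apply/subsetP=> _ /morphimP[g _ Gg ->]; apply: fG.
by exists (aut injf Gf); [exact: Aut_aut | move=> g Gg; exact: autE].
Qed.

Lemma cube_eq1 g : coprime #|G| 3 -> g \in G -> g ^+ 3 = 1 -> g = 1.
Proof.
move=> co3 Gg /eqP; rewrite -order_dvdn => dv; apply/eqP; rewrite -order_eq1 -dvdn1.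
by rewrite -(eqP co3) dvdn_gcd order_dvdG.
Qed.

Lemma cube_root_in g A : coprime #|G| 3 -> g \in G -> g ^+ 3 \in A -> g \in A.
Proof.
by move=> co3 Gg; apply: coprime_root_in; apply: coprime_dvdl co3; apply: order_dvdG.
Qed.

(** If t lies outside K, sending every g outside K to g^3 forces k to go to
    k^t k^2; this is injective as soon as no element of order 3 is central. *)
Lemma structureII_automorphism :
    structureII G ->
  exists2 alpha : {perm gT}, alpha \in Aut G & #|G| < 2 * #|cubed_set G alpha|.
Proof.
case=> nabG [S [sylS nSG [K [sSK sKG iGK abK]] tiSZ]].
have [t Gt nKt] : exists2 t, t \in G & t \notin K.
  by apply/subsetPn; apply: contra nabG => sGK; apply: abelianS abK.
have nKG : K <| G by apply: index2_normal.
have cK : {in K &, forall k l, commute k l} by move=> k l Kk Kl; apply: (centsP abK).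
have Kmul g h : g \in G -> h \in G -> (g * h \in K) = ((g \in K) == (h \in K)).
  by move=> Gg Gh; apply: index2_mul iGK Gg Gh.
have KJ k g : k \in K -> g \in G -> k ^ g \in K.
  by move=> Kk Gg; rewrite memJ_norm // (subsetP (normal_norm nKG)).
have JE k g : k \in K -> g \in G -> g \notin K -> k ^ g = k ^ t.
  move=> Kk Gg nKg; rewrite -(mulgKV t g) conjgM.
  have Kgt : g * t^-1 \in K by rewrite Kmul ?groupV // (negPf nKg) (negPf nKt).
  by congr (_ ^ t); apply/conjg_fixP/commgP/cK.
have J2 k g : k \in K -> g \in G -> k ^ (g ^+ 2) = k.
  move=> Kk Gg; apply/conjg_fixP/commgP/cK => //.
  by rewrite expgS expg1 Kmul // eqxx.
pose f g := if g \in K then g ^ t * g ^+ 2 else g ^+ 3.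
have fK k : k \in K -> f k = k ^ t * k ^+ 2 by rewrite /f => ->.
have fN g : g \notin K -> f g = g ^+ 3 by rewrite /f => /negPf->.
have f_right g k : k \in K -> g \in G -> g \notin K -> f (g * k) = f g * f k.
  move=> Kk Gg nKg; have Gk := subsetP sKG k Kk.
  rewrite (fN (g * k)) ?groupMr // (fN g) // (fK k) // -(JE k g) //.
  have -> : (g * k) ^+ 3 = g ^+ 3 * (k ^ (g ^+ 2) * k ^ g * k) by reduce_words.
  by rewrite J2 // (cK k (k ^ g)) ?KJ // -[in LHS](mulgA (k ^ g)).
have f_left g k : k \in K -> g \in G -> g \notin K -> f (k * g) = f k * f g.
  move=> Kk Gg nKg; have Gk := subsetP sKG k Kk.
  have -> : k * g = g * k ^ g by apply: conjgC.
  rewrite f_right ?KJ // (fN g) // (fK k) // (fK (k ^ g)) ?KJ // [RHS]conjgC; congr (_ * _).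
  have Kw : k ^ t * k ^+ 2 \in K by rewrite groupM ?KJ ?groupX.
  by rewrite (expgSr g 2) conjgM J2 // [RHS]conjMg conjXg -(JE k g) // -(JE (k ^ g) g) ?KJ.
have f_in g h : g \in K -> h \in K -> f (g * h) = f g * f h.
  move=> Kg Kh; rewrite !fK ?groupM // conjMg expgMn; last exact: cK.
  have Kht : h ^ t \in K by apply: KJ.
  rewrite -(mulgA (g ^ t) (h ^ t)) -(mulgA (g ^ t) (g ^+ 2)); congr (_ * _).
  by rewrite (mulgA (h ^ t)) (cK (h ^ t) (g ^+ 2)) ?groupX // -(mulgA (g ^+ 2)).
have fM : {in G &, {morph f : g h / g * h}}.
  move=> g h Gg Gh; have [Kg | nKg] := boolP (g \in K); have [Kh | nKh] := boolP (h \in K).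
  - exact: f_in.
  - exact: f_left.
  - exact: f_right.
  pose k := g^-1 * h; have Kk : k \in K by rewrite Kmul ?groupV // (negPf nKg) (negPf nKh).
  have -> : h = g * k by rewrite mulKVg.
  have Kg2 : g * g \in K by rewrite Kmul // eqxx.
  rewrite (f_right g k) // [LHS](congr1 f (mulgA g g k)) f_in // mulgA; congr (_ * _).
  rewrite (fK (g * g)) // (fN g) // -(JE _ g) //; reduce_words.
  by [].
have fG g : g \in G -> f g \in G.
  move=> Gg; rewrite /f; case: ifP => _; last exact: groupX.
  by apply: groupM; [exact: groupJ | exact: groupX].
have f1 : {in G, forall g, f g = 1 -> g = 1}.
  move=> g Gg; have [Kg | nKg] := boolP (g \in K); last first.
    rewrite fN // => g3; case/negP: nKg.
    have <- : (g * g)^-1 = g.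
      by apply: (mulIg (g * g)); rewrite mulVg -g3; reduce_words.
    by rewrite groupV Kmul // eqxx.
  rewrite fK // => fg.
  have gt : g ^ t = g ^- 2 by apply: (mulIg (g ^+ 2)); rewrite fg mulVg.
  have g3 : g ^+ 3 = 1.
    have := J2 g t Kg Gt; rewrite expgS expg1 conjgM gt conjVg conjXg gt => g4.
    apply: (mulIg g); rewrite mul1g -[in RHS]g4; by reduce_words.
  have gZ : g \in 'Z(G).
    have cgt : commute g t.
      apply/commgP/conjg_fixP; rewrite gt; apply: (mulIg (g ^+ 2)).
      by rewrite mulVg -expgS g3.
    apply/centerP; split=> // h Gh; have [Kh | nKh] := boolP (h \in K); first exact: cK.
    rewrite -(mulgKV t h); apply: commuteM => //.
    by apply: cK => //; rewrite Kmul ?groupV // (negPf nKh) (negPf nKt).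
  have Sg : g \in S.
    rewrite (mem_normal_Hall sylS) // /p_elt.
    have : #[g] %| 3 by rewrite order_dvdn g3.
    by move/pnat_dvd; apply; rewrite pnat_id.
  by apply/set1P; rewrite -[[set 1]]tiSZ inE Sg.
have [alpha autG aE] := automorphism_of fM fG f1; exists alpha => //.
have sub : 1 |: (G :\: K) \subset cubed_set G alpha.
  apply/subsetP=> g /setU1P[-> | /setDP[Gg nKg]]; first exact: cubed_one.
  by apply/cubedP; rewrite Gg aE // fN.
have := subset_leq_card sub; rewrite cardsU1 in_setD group1 /=.
have := cardsID K G; rewrite (setIidPr sKG); have := Lagrange sKG; rewrite iGK.
by card_lia.
Qed.

Lemma comm_cube_class2 (a x : gT) :
    a \in G -> x \in G -> [~ x, a] \in 'Z(G) -> [~ x, a] ^+ 2 = 1 ->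
  x ^+ 3 * a ^+ 3 = a ^+ 3 * x ^+ 3 * [~ x, a].
Proof.
move=> Ga Gx /centerP[_ cZ] c2.
rewrite commgC commXXg; [|exact/commute_sym/cZ ..].
by rewrite (_ : (3 * 3 = 4 * 2 + 1)%N) // expgD mulnC expgM c2 expg1n mul1g.
Qed.

(** When G = A X, sending a x to a^3 x^3 is a homomorphism as soon as the
    commutators [x, a] are central of order dividing 2 and lie in A, since
    then [x^3, a^3] = [x, a]^9 = [x, a]^3. *)
Lemma split_cubing A X :
    abelian A -> abelian X -> A * X = G -> 'Z(G) \subset A -> coprime #|G| 3 ->
    {in A & X, forall a x, [~ x, a] \in 'Z(G) /\ [~ x, a] ^+ 2 = 1} ->
  exists2 alpha : {perm gT}, alpha \in Aut G &
    {in A & X, forall a x, alpha (a * x) = a ^+ 3 * x ^+ 3}.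
Proof.
move=> abA abX AXG sZA co3 commZ.
have sAG : A \subset G by rewrite -AXG mulG_subl.
have sXG : X \subset G by rewrite -AXG mulG_subr.
have cA : {in A &, forall a b, commute a b} by move=> a b Aa Ab; apply: (centsP abA).
have cX : {in X &, forall a b, commute a b} by move=> a b Aa Ab; apply: (centsP abX).
pose f g := divgr A X g ^+ 3 * remgr A X g ^+ 3.
have Adiv g : g \in G -> divgr A X g \in A by move=> Gg; apply: mem_divgr; rewrite AXG.
have Xrem g : g \in G -> remgr A X g \in X by move=> Gg; apply: mem_remgr; rewrite AXG.
have fE a x : a \in A -> x \in X -> f (a * x) = a ^+ 3 * x ^+ 3.
  move=> Aa Xx; have Gax : a * x \in G by rewrite -AXG mem_mulg.
  rewrite /f; have := divgr_eq A X (a * x).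
  move: (divgr A X (a * x)) (remgr A X (a * x)) (Adiv _ Gax) (Xrem _ Gax) => b y Ab Xy E.
  have [c [Ac Xc aE yE]] : exists c, [/\ c \in A, c \in X, a = b * c & y = c * x].
    exists (b^-1 * a); split; rewrite ?mulKVg //; first by rewrite groupM ?groupV.
      have -> : b^-1 * a = y * x^-1 by rewrite -(mulgK x a) E mulgA mulKg.
      by rewrite groupM ?groupV.
    by rewrite -mulgA E mulKg.
  rewrite aE yE (expgMn _ (cA b c Ab Ac)) (expgMn _ (cX c x Xc Xx)).
  by rewrite -!(mulgA (b ^+ 3)).
have split_elt g : g \in G -> exists a x, [/\ a \in A, x \in X & g = a * x].
  by rewrite -AXG => /mulsgP[a x Aa Xx ->]; exists a, x.
have fM : {in G &, {morph f : g h / g * h}}.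
  move=> _ _ /split_elt[a [x [Aa Xx ->]]] /split_elt[b [y [Ab Xy ->]]].
  have [Zk k2] := commZ b x Ab Xx; have [Gb Gx] := (subsetP sAG b Ab, subsetP sXG x Xx).
  have k3 : [~ x, b] ^+ 3 = [~ x, b] by rewrite expgSr k2 mul1g.
  have Ak := subsetP sZA _ Zk; have /centerP[_ cZ] := Zk.
  have -> : a * x * (b * y) = (a * b * [~ x, b]) * (x * y).
    have E : x * b = b * [~ x, b] * x.
      by rewrite {1}(commgC x b) -(mulgA b x) -(mulgA b [~ x, b]) cZ.
    rewrite -(mulgA a x) (mulgA x b y) E; move: [~ x, b] => k; by reduce_words.
  have Aab := groupM Aa Ab; have Xxy := groupM Xx Xy.
  rewrite (fE _ _ (groupM Aab Ak) Xxy) (fE a x) // (fE b y) //.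
  rewrite (expgMn _ (cA _ _ Aab Ak)) (expgMn _ (cA a b Aa Ab)).
  rewrite (expgMn _ (cX x y Xx Xy)) k3.
  rewrite -!(mulgA (a ^+ 3)); congr (_ * _); rewrite !(mulgA _ _ (y ^+ 3)); congr (_ * _).
  rewrite comm_cube_class2 // -!(mulgA (b ^+ 3)); congr (_ * _).
  by apply: cZ; rewrite groupX.
have fG g : g \in G -> f g \in G.
  move=> /split_elt[a [x [Aa Xx ->]]]; rewrite fE // groupM ?groupX //.
    exact: (subsetP sAG).
  exact: (subsetP sXG).
have f1 : {in G, forall g, f g = 1 -> g = 1}.
  move=> g Gg; have [a [x [Aa Xx gE]]] := split_elt g Gg.
  have [Ga Gx] := (subsetP sAG a Aa, subsetP sXG x Xx).
  rewrite gE fE // => fg.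
  have ax : x ^+ 3 = a ^- 3 by apply: (mulgI (a ^+ 3)); rewrite fg mulgV.
  have Ax : x \in A by apply: (cube_root_in co3) => //; rewrite ax groupV groupX.
  apply: (cube_eq1 co3); first by rewrite groupM.
  by rewrite expgMn //; apply: cA.
have [alpha autG aE] := automorphism_of fM fG f1; exists alpha => // a x Aa Xx.
by rewrite aE ?fE // -AXG mem_mulg.
Qed.

(** The product a x is cubed when a and x commute, and every element of G is
    such a product in as many ways as A and X have common elements. *)
Lemma split_cubing_majority A X :
    abelian A -> abelian X -> A * X = G -> 'Z(G) \subset A -> coprime #|G| 3 ->
    {in A & X, forall a x, [~ x, a] \in 'Z(G) /\ [~ x, a] ^+ 2 = 1} ->
    (#|A| * #|X| < \sum_(a in A) 2 * #|'C_X[a]|)%N ->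
  exists2 alpha : {perm gT}, alpha \in Aut G & #|G| < 2 * #|cubed_set G alpha|.
Proof.
move=> abA abX AXG sZA co3 commZ ltC.
have [alpha autG aE] := split_cubing abA abX AXG sZA co3 commZ; exists alpha => //.
set T := cubed_set G alpha.
have sAG : A \subset G by rewrite -AXG mulG_subl.
have sXG : X \subset G by rewrite -AXG mulG_subr.
have fiber : (\sum_(a in A) #|T :&: a *: X| = #|T| * #|A :&: X|)%N.
  rewrite (eq_bigr (fun a => \sum_(t in T) (t \in a *: X))%N) => [|a _]; last first.
    by rewrite -big_mkcondr /= sum1dep_card; apply: eq_card => t; rewrite inE.
  rewrite exchange_big /= -sum_nat_const; apply: eq_bigr => t Tt.
  rewrite -big_mkcondr /= sum1dep_card.
  have : t \in A * X by rewrite AXG (cubed_in Tt).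
  case/mulsgP=> a x Aa Xx tE; rewrite -(card_lcoset (A :&: X) a); apply: eq_card => b.
  rewrite [LHS]in_set !mem_lcoset in_setI.
  have -> : (a^-1 * b \in A) = (b \in A) by rewrite groupMl ?groupV.
  rewrite tE mulgA groupMr // -[b^-1 * a]invgK invMg invgK groupV.
  by [].
have leCT a : a \in A -> #|'C_X[a]| <= #|T :&: a *: X|.
  move=> Aa; rewrite -(card_lcoset 'C_X[a] a); apply/subset_leq_card.
  apply/subsetP=> _ /lcosetP[x /setIP[Xx /cent1P cx] ->].
  have [Ga Gx] := (subsetP sAG a Aa, subsetP sXG x Xx).
  rewrite in_setI mem_lcoset mulKg Xx andbT; apply/cubedP; split; first exact: groupM.
  by rewrite aE // expgMn //; apply: commute_sym.
rewrite -(ltn_pmul2r (cardG_gt0 (A :&: X)%G)) /= -mulnA -fiber -{1}AXG -mul_cardG.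
apply: leq_trans ltC _; rewrite big_distrr /=; apply: leq_sum => a Aa.
by rewrite leq_mul2l leCT.
Qed.

(** Each a outside Z0 and R commutes with at least half of X.  The surplus on Z0
    covers the deficit on R, since even there a commutes with 1. *)
Lemma commuting_majority A X (Z0 R : {set gT}) :
    Z0 \subset A -> {in Z0, forall a, X \subset 'C[a]} -> 0 < #|Z0| -> #|R| <= #|Z0| ->
    {in A, forall a, a \notin Z0 -> a \notin R -> #|X| <= 2 * #|'C_X[a]|} ->
  (#|A| * #|X| < \sum_(a in A) 2 * #|'C_X[a]|)%N.
Proof.
move=> sZA cZ Z0_gt0 leRZ half.
rewrite (big_setID Z0) /= (setIidPr sZA) (big_setID (A := A :\: Z0) R) /=.
have E1 : (\sum_(a in Z0) 2 * #|'C_X[a]| = #|Z0| * (2 * #|X|))%N.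
  rewrite -sum_nat_const; apply: eq_bigr => a Za.
  by rewrite (setIidPl (cZ a Za)).
have E2 : (#|(A :\: Z0) :&: R| * 1 <= \sum_(a in (A :\: Z0) :&: R) 2 * #|'C_X[a]|)%N.
  by rewrite -sum_nat_const; apply: leq_sum => a _; rewrite muln_gt0 cardG_gt0.
have E3 : (#|A :\: Z0 :\: R| * #|X| <= \sum_(a in A :\: Z0 :\: R) 2 * #|'C_X[a]|)%N.
  rewrite -sum_nat_const; apply: leq_sum => a /setDP[/setDP[Aa nZa] nRa]; exact: half.
have ER : #|(A :\: Z0) :&: R| <= #|Z0| by apply: leq_trans leRZ; rewrite subset_leq_card ?subsetIr.
have := cardsID R (A :\: Z0); have := cardsID Z0 A; rewrite (setIidPr sZA) => <- <-.
rewrite E1; move: E2 E3 ER Z0_gt0 (cardG_gt0 X).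
move: #|(A :\: Z0) :&: R| #|A :\: Z0 :\: R| #|Z0| #|X| => r n z m.
move: (\sum_(a in _) _)%N (\sum_(a in _) _)%N => s1 s2 E2 E3 ER z0 m0.
have : (r * m <= z * m)%N by rewrite leq_mul2r ER orbT.
rewrite !mulnDl muln1 in E2 *.
have [r0 | r_gt0] := posnP r; last by lia.
have : (0 < z * m)%N by rewrite muln_gt0 z0.
by rewrite r0; lia.
Qed.

Lemma structureI_automorphism :
    structureI G ->
  exists2 alpha : {perm gT}, alpha \in Aut G & #|G| < 2 * #|cubed_set G alpha|.
Proof.
case=> abG co3; apply: (@split_cubing_majority G 1%G) => //.
- exact: abelian1.
- by rewrite mulg1.
- exact: center_sub.
- by move=> a x _ /set1P->; rewrite comm1g group1 expg1n.
apply: (@commuting_majority G 1%G G set0) => //; rewrite ?cards0 //.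
- by move=> a _; apply: sub1G.
by move=> a ->.
Qed.

Section ClassTwoGroups.

Variable S : {group gT}.
Hypothesis nilG : nilpotent G.
Hypothesis cl2 : nil_class G = 2.
Hypothesis co3 : coprime #|G| 3.
Hypothesis oddP : forall (p : nat) (P : {group gT}),
  prime p -> 2 < p -> p.-Sylow(G) P -> abelian P.
Hypothesis sylS : 2.-Sylow(G) S.
Hypothesis abelS : 2.-abelem (S / 'Z(S)).

Let sSG : S \subset G := pHall_sub sylS.

Lemma class2_derived : G^`(1) \subset 'Z(G).
Proof. by rewrite -nil_class2 cl2. Qed.

Lemma class2_comm g k : g \in G -> k \in G -> [~ g, k] \in 'Z(G).
Proof. by move=> Gg Gk; apply: (subsetP class2_derived); apply: mem_commg. Qed.

(** In a nilpotent group, Sylow subgroups for different primes commute. *)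
Lemma odd_Sylow_central p P : prime p -> 2 < p -> p.-Sylow(G) P -> P \subset 'Z(G).
Proof.
move=> pr_p p2 sylP; rewrite subsetI (pHall_sub sylP) centsC -(Sylow_gen G) gen_subG.
apply/bigcupsP=> Q /SylowP[q pr_q sylQ].
have [E | npq] := eqVneq q p.
  rewrite E in sylQ; rewrite (nilpotent_Hall_pcore nilG sylQ) -(nilpotent_Hall_pcore nilG sylP).
  exact: oddP pr_p p2 sylP.
apply: (sub_nilpotent_cent2 nilG (pHall_sub sylP) (pHall_sub sylQ)).
apply: pnat_coprime (pHall_pgroup sylP) _.
by apply: sub_in_pnat (pHall_pgroup sylQ) => r _ /eqnP->; rewrite !inE.
Qed.

Lemma Sylow_mul_center : G \subset S <*> 'Z(G).
Proof.
rewrite -{1}(Sylow_gen G) gen_subG; apply/bigcupsP=> Q /SylowP[q pr_q sylQ].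
have [E | nq2] := eqVneq q 2.
  rewrite E in sylQ; rewrite (nilpotent_Hall_pcore nilG sylQ) -(nilpotent_Hall_pcore nilG sylS).
  exact: joing_subl.
apply: subset_trans (joing_subr _ _); apply: odd_Sylow_central sylQ => //.
by rewrite ltn_neqAle eq_sym nq2 prime_gt1.
Qed.

Lemma Sylow_center_factor g : g \in G -> exists s c, [/\ s \in S, c \in 'Z(G) & g = s * c].
Proof.
move=> Gg; have := subsetP Sylow_mul_center g Gg; rewrite cent_joinEr.
  by case/mulsgP=> s c Ss Zc ->; exists s, c.
by rewrite (subset_trans (subsetIr _ _)) // centS.
Qed.

Lemma center_Sylow_sub : 'Z(S) \subset 'Z(G).
Proof.
apply/subsetP=> u /centerP[Su cu]; apply/centerP; split=> [|g Gg]; first exact: (subsetP sSG).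
have [s [c [Ss /centerP[Gc cc] ->]]] := Sylow_center_factor Gg.
apply: commuteM; first exact: cu.
by apply/commute_sym/cc/(subsetP sSG).
Qed.

Lemma class2_sqr g : g \in G -> g ^+ 2 \in 'Z(G).
Proof.
move=> Gg; have [s [c [Ss Zc ->]]] := Sylow_center_factor Gg.
have Gs := subsetP sSG s Ss; have /centerP[_ cc] := Zc.
rewrite expgMn; last exact/commute_sym/cc.
apply: groupM; [apply: (subsetP center_Sylow_sub) | exact: groupX].
have nZs : s \in 'N('Z(S)) := subsetP (normal_norm (center_normal S)) s Ss.
have nZs2 : s ^+ 2 \in 'N('Z(S)) by rewrite groupX.
apply: (coset_idr nZs2).
have [_ s2] := abelemP (isT : prime 2) abelS.
by rewrite morphX // s2 // mem_quotient.
Qed.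

Lemma class2_comm_sqr g k : g \in G -> k \in G -> [~ g, k] ^+ 2 = 1.
Proof.
move=> Gg Gk; apply: comm_sqr_trivial; apply: (@central_comm _ G) => //.
  exact: class2_comm.
exact: class2_sqr.
Qed.

Lemma comm_Sylow g k : g \in G -> k \in G -> [~ g, k] \in S^`(1).
Proof.
move=> Gg Gk; have [s [c [Ss Zc ->]]] := Sylow_center_factor Gg.
have [t [d [St Zd ->]]] := Sylow_center_factor Gk.
have /centerP[Gc cc] := Zc; have /centerP[Gd cd] := Zd.
have [Gs Gt] := (subsetP sSG s Ss, subsetP sSG t St).
have -> : [~ s * c, t * d] = [~ s, t]; last exact: mem_commg.
rewrite commMgJ commgMJ.
have -> : [~ c, t * d] = 1 by apply/eqP/commgP/cc; rewrite groupM.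
have -> : [~ s, d] = 1 by apply/eqP/commgP/commute_sym/cd.
rewrite mulg1 mul1g -conjgM; apply/conjg_fixP/commgP/commute_sym.
have /centerP[_ cst] := class2_comm Gs Gt.
by apply/commute_sym/cst; rewrite groupM.
Qed.

Section Hyperbolic.

Variables (k : nat) (x a z : 'I_k -> gT).
Hypothesis hyp : hyperbolic_generators S x a z.

Let A := (<<[set a i | i : 'I_k]>> <*> 'Z(G))%G.
Let X := (<<[set x i | i : 'I_k]>> <*> 'Z(G))%G.

Lemma commuting_join_abelian (y : 'I_k -> gT) :
    (forall i, y i \in G) -> (forall i j, i != j -> [~ y i, y j] = 1) ->
  abelian (<<[set y i | i : 'I_k]>> <*> 'Z(G)).
Proof.
move=> Gy yC; rewrite abelianY center_abelian abelian_gen andTb; apply/andP; split.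
  apply/centsP=> _ /imsetP[i _ ->] _ /imsetP[j _ ->].
  have [-> // | nij] := eqVneq i j; apply/commgP/eqP; exact: yC.
rewrite (subset_trans (subsetIr _ _)) // centS // gen_subG.
by apply/subsetP=> _ /imsetP[i _ ->].
Qed.

Let GS i : x i \in G /\ a i \in G.
Proof. by case: hyp => xaS _ _ _; case: (xaS i) => /(subsetP sSG) ? /(subsetP sSG) ?. Qed.

Lemma hyperbolic_abelian : abelian A /\ abelian X.
Proof.
case: hyp => _ _ off _; split; apply: commuting_join_abelian.
- by move=> i; case: (GS i).
- by move=> i j /off[].
- by move=> i; case: (GS i).
by move=> i j /off[].
Qed.

(** As A contains Z(G), hence G', it is normal and A X is a group; it contains
    Z(S) and elements of S generating S / Z(S). *)
Lemma hyperbolic_mul : A * X = G.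
Proof.
case: hyp => xaS SE _ _.
have sYG (y : 'I_k -> gT) : (forall i, y i \in G) -> <<[set y i | i : 'I_k]>> <*> 'Z(G) \subset G.
  move=> Gy; rewrite join_subG center_sub andbT gen_subG.
  by apply/subsetP=> _ /imsetP[i _ ->].
have sAG : A \subset G by apply: sYG => i; case: (GS i).
have sXG : X \subset G by apply: sYG => i; case: (GS i).
have nAG : A <| G.
  apply: sub_der1_normal => //; apply: subset_trans class2_derived _; exact: joing_subr.
rewrite -norm_joinEr; last exact: subset_trans sXG (normal_norm nAG).
apply/eqP; rewrite eqEsubset join_subG sAG sXG /=.
apply: subset_trans Sylow_mul_center _; rewrite join_subG andbC; apply/andP; split.
  exact: subset_trans (joing_subr _ _) (joing_subl _ _).
set U := [set x i | i : 'I_k] :|: [set a i | i : 'I_k].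
have sUS : U \subset S.
  by rewrite subUset; apply/andP; split; apply/subsetP=> _ /imsetP[i _ ->]; case: (xaS i).
have nZS : S \subset 'N('Z(S)) := normal_norm (center_normal S).
have : S \subset 'Z(S) * <<U>>.
  rewrite -quotientSK // SE quotient_gen ?(subset_trans sUS) //.
  rewrite [U / _]quotientE morphimEsub ?(subset_trans sUS) // imsetU -!imset_comp.
  exact: subxx.
move/subset_trans; apply; rewrite mul_subG //.
  apply: subset_trans center_Sylow_sub _.
  exact: subset_trans (joing_subr _ _) (joing_subl _ _).
rewrite gen_subG subUset; apply/andP; split.
  apply: subset_trans (joing_subr _ _); apply: subset_trans (joing_subl _ _); exact: subset_gen.
apply: subset_trans (joing_subl _ _); apply: subset_trans (joing_subl _ _); exact: subset_gen.
Qed.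

Lemma hyperbolic_automorphism :
    (#|A| * #|X| < \sum_(b in A) 2 * #|'C_X[b]|)%N ->
  exists2 alpha : {perm gT}, alpha \in Aut G & #|G| < 2 * #|cubed_set G alpha|.
Proof.
have [abA abX] := hyperbolic_abelian; have AXG := hyperbolic_mul.
apply: split_cubing_majority => //; first exact: joing_subr.
move=> b y Ab Xy; have Gb : b \in G by rewrite -AXG (subsetP (mulG_subl _ _)).
have Gy : y \in G by rewrite -AXG (subsetP (mulG_subr _ _)).
by split; [exact: class2_comm | exact: class2_comm_sqr].
Qed.

Lemma half_commuting b w : b \in G -> {in X, forall y, [~ b, y] \in [set 1; w]} ->
  #|X| <= 2 * #|'C_X[b]|.
Proof.
move=> Gb bX; rewrite -(Lagrange (subsetIl X 'C[b])) mulnC leq_mul2r index_cent1.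
apply/orP; right; apply: leq_trans (_ : #|[set b; b * w]| <= 2); last first.
  by rewrite cards2; case: (_ != _).
apply/subset_leq_card/subsetP=> _ /imsetP[y Xy ->].
have := bX y Xy; rewrite commgEl => /set2P[] /(congr1 (mulg b)); rewrite mulKVg ?mulg1 => ->.
  exact: set21.
exact: set22.
Qed.

End Hyperbolic.

Lemma odd_power_coset b n : b \in G -> b ^+ n \in b ^+ odd n *: 'Z(G).
Proof.
move=> Gb; rewrite -{1}(odd_double_half n) expgD mem_lcoset mulKg -mul2n expgM.
by rewrite groupX ?class2_sqr.
Qed.

Lemma structureIIIi_automorphism :
    structureIIIi S ->
  exists2 alpha : {perm gT}, alpha \in Aut G & #|G| < 2 * #|cubed_set G alpha|.
Proof.
case=> z [k [x [a [dS oz _ _ hyp]]]].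
apply: (hyperbolic_automorphism hyp); have AXG := hyperbolic_mul hyp.
apply: (@commuting_majority _ _ [set 1] set0); rewrite ?sub1set ?cards1 ?cards0 //.
  by move=> b /set1P->; rewrite cent11T subsetT.
move=> b Ab _ _; apply: (half_commuting (w := z)) => // [|y Xy].
  by rewrite -AXG; apply: subsetP Ab; apply: mulG_subl.
rewrite -cycle2g // -dS; apply: comm_Sylow; rewrite -AXG.
  by apply: subsetP Ab; apply: mulG_subl.
by apply: subsetP Xy; apply: mulG_subr.
Qed.

(** Modulo Z(G) the group A consists of 1, a0, a1 and a0 a1.  Each of a0 and a1
    commutes with at least half of X, and the coset of a0 a1 is no larger than
    Z(G), all of which commutes with X. *)
Lemma structureIIIii_automorphism :
    structureIIIii S ->
  exists2 alpha : {perm gT}, alpha \in Aut G & #|G| < 2 * #|cubed_set G alpha|.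
Proof.
case=> z [x [a [_ oz _ _ hyp]]].
pose A := (<<[set a i | i : 'I_2]>> <*> 'Z(G))%G.
pose X := (<<[set x i | i : 'I_2]>> <*> 'Z(G))%G.
apply: (hyperbolic_automorphism hyp); rewrite -/A -/X.
have AXG : A * X = G := hyperbolic_mul hyp.
have [_ _ off diag] := hyp; have [xaS _ _ _] := hyp.
have GS i : x i \in G /\ a i \in G.
  by case: (xaS i) => /(subsetP sSG) ? /(subsetP sSG) ?.
have [Gx Ga] : (forall i, x i \in G) /\ (forall i, a i \in G).
  by split=> i; case: (GS i).
have GX y : y \in X -> y \in G by move=> Xy; rewrite -AXG (subsetP (mulG_subr _ _)).
have Zz i : z i \in 'Z(G) by rewrite -diag class2_comm.
have two_cases (i : 'I_2) : i = ord0 \/ i = ord_max.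
  by case: i => [[|[|//]] lti]; [left | right]; apply: val_inj.
have aX i y : y \in X -> [~ a i, y] \in <[z i]>.
  have sWZ : <[z i]> \subset 'Z(G) by rewrite cycle_subG.
  have saG : [set a i] \subset G by rewrite sub1set.
  pose M := Group (comm_central_group_set saG sWZ (groupP <[z i]>)).
  have inM g : g \in G -> [~ a i, g] \in <[z i]> -> g \in M.
    by move=> Gg ag; apply/setIdP; split=> //; apply/forall_inP=> _ /set1P->.
  suff sXM : X \subset M.
    by move=> Xy; have /setIdP[_ /forall_inP->] := subsetP sXM y Xy; rewrite ?set11.
  suff : <<[set x i | i : 'I_2]>> <*> 'Z(G) \subset M by [].
  rewrite join_subG gen_subG; apply/andP; split; apply/subsetP=> g.
    case/imsetP=> j _ ->; apply: inM => //; have [-> | nij] := eqVneq i j.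
      by rewrite diag cycle_id.
    by case: (off i j nij) => _ _ ->; apply: group1.
  case/centerP=> Gg cg; apply: inM => //.
  by have -> : [~ a i, g] = 1; [apply/eqP/commgP/commute_sym/cg | apply: group1].
set a0 := a ord0; set a1 := a ord_max.
have Aform b : b \in A -> exists i j : bool, b \in a0 ^+ i * a1 ^+ j *: 'Z(G).
  rewrite /A /= cent_joinEr; last first.
    rewrite (subset_trans (subsetIr _ _)) // centS // gen_subG.
    by apply/subsetP=> _ /imsetP[i _ ->].
  case/mulsgP=> u c Uu Zc ->.
  have: u \in <[a0]> * <[a1]>.
    rewrite -cent_joinEr; last first.
      rewrite /= cent_cycle cycle_subG; apply/cent1P/commgP/eqP.
      by case: (off ord_max ord0 isT).
    apply: subsetP Uu; rewrite gen_subG; apply/subsetP=> _ /imsetP[i _ ->].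
    by case: (two_cases i) => ->; rewrite mem_gen // inE cycle_id ?orbT.
  case/mulsgP=> _ _ /cycleP[m ->] /cycleP[n ->] ->; exists (odd m), (odd n).
  have /lcosetP[c0 Zc0 ->] := odd_power_coset m (Ga ord0).
  have /lcosetP[c1 Zc1 ->] := odd_power_coset n (Ga ord_max).
  rewrite mem_lcoset.
  have -> : (a0 ^+ odd m * a1 ^+ odd n)^-1 * (a0 ^+ odd m * c0 * (a1 ^+ odd n * c1) * c) =
      (c0 ^ (a1 ^+ odd n)) * c1 * c by reduce_words.
  have nZ : a1 ^+ odd n \in 'N('Z(G)).
    by apply: (subsetP (normal_norm (center_normal G))); rewrite groupX ?Ga.
  have ZJ : c0 ^ (a1 ^+ odd n) \in 'Z(G) by rewrite memJ_norm.
  exact: groupM (groupM ZJ Zc1) Zc.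
apply: (@commuting_majority _ _ 'Z(G) (a0 * a1 *: 'Z(G))).
- exact: joing_subr.
- move=> c /centerP[_ cc]; apply/subsetP=> y Xy; apply/cent1P/commute_sym/cc; exact: GX.
- exact: cardG_gt0.
- by rewrite card_lcoset.
move=> b Ab nZb nRb; have [i [j bE]] := Aform b Ab.
have [l bl] : exists l, b \in a l *: 'Z(G).
  case: i j bE => [] []; rewrite ?expg1 ?expg0 ?mulg1 ?mul1g => bE.
  - by rewrite bE in nRb.
  - by exists ord0.
  - by exists ord_max.
  by rewrite bE in nZb.
case/lcosetP: bl => c Zc bE'.
have Gb : b \in G by rewrite bE' groupM //; case/centerP: Zc.
apply: (half_commuting (w := z l) Gb) => y Xy; rewrite -cycle2g //.
have -> : [~ b, y] = [~ a l, y]; last exact: aX.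
have /centerP[_ cc] := Zc.
rewrite bE' commMgJ; have -> : [~ c, y] = 1 by apply/eqP/commgP/cc/GX.
rewrite mulg1; apply/conjg_fixP/commgP/commute_sym/cc.
by rewrite groupR // GX.
Qed.

End ClassTwoGroups.

Lemma structureIII_automorphism :
    structureIII G ->
  exists2 alpha : {perm gT}, alpha \in Aut G & #|G| < 2 * #|cubed_set G alpha|.
Proof.
case=> nilG cl2 co3 oddP [S [sylS structS]].
have abelS : 2.-abelem (S / 'Z(S)).
  by case: structS => [[z [k [x [a []]]]] | [z [x [a []]]]].
case: structS => [struct | struct].
  exact: structureIIIi_automorphism struct.
exact: structureIIIii_automorphism struct.
Qed.

End Sufficiency.

Theorem theorem3p1 (gT : finGroupType) (G : {group gT}) :
  ((exists2 alpha : {perm gT}, alpha \in Aut G & (1 / 2 < cube_ratio G alpha)%R)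
     <-> [\/ structureI G, structureII G | structureIII G])
  /\ (~~ abelian G -> coprime #|G| 3 ->
      (exists K : {group gT}, [/\ K \subset G, #|G : K| = 2 & abelian K]) ->
      structureII G).
Proof.
split; last first.
  move=> nabG co3 [K [sKG iGK abK]]; apply: structureII_index2 iGK abK _ => //.
  exact: coprime_dvdl (cardSg (center_sub G)) co3.
split=> [[alpha autG] | structG].
  by rewrite cube_ratio_gt; apply: large_cubed_structure.
have [alpha autG ltT] : exists2 alpha : {perm gT}, alpha \in Aut G & #|G| < 2 * #|cubed_set G alpha|.
  case: structG; first exact: structureI_automorphism.
    exact: structureII_automorphism.
  exact: structureIII_automorphism.
by exists alpha; rewrite ?cube_ratio_gt.
Qed.
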